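(* Let $0<a\leq b<+\infty$ and $\nu=\frac{1}{2}\delta_a+\frac{1}{2}\delta_b$. Let $E$ be the set of (unoriented, nearest-neighbour) edges of the lattice $\mathbb{Z}^2$, and let $\mu=\nu^{\otimes E}$, i.e. the resistances $(r_e)_{e\in E}$ are i.i.d. with law $\nu$. For $v\in\mathbb{Z}^2$ let $\mathcal{R}_r(0\leftrightarrow v)$ denote the effective resistance between $0$ and $v$. Then there is a constant $C>0$ such that for all $v$ with $|v|$ large enough, $$\operatorname{Var}_\mu\big(\mathcal{R}_r(0\leftrightarrow v)\big)\leq C(\log |v|)^{2/3},$$ where $|v|$ denotes the $\ell^1$-norm of $v$.
   Context: For each unoriented edge $e=\{x,y\}$ there are two oriented edges $\overrightarrow{xy},\overrightarrow{yx}$. A flow from a vertex $x_0$ to a vertex $y_0$ with strength $1$ is a function $\theta$ on oriented edges which is antisymmetric ($\theta(\overrightarrow{xy})=-\theta(\overrightarrow{yx})$), satisfies the node law $\sum_{y\sim x}\theta(\overrightarrow{xy})=0$ at every vertex $x\notin\{x_0,y_0\}$, and has net outflow $\sum_{y\sim x_0}\theta(\overrightarrow{x_0y})=1$ at $x_0$ (and net inflow $1$ at $y_0$). Since $\theta(e)^2$ does not depend on orientation it is defined for unoriented edges. Given positive resistances $r=(r_e)_{e\in E}$, the effective resistance is $\mathcal{R}_r(x_0\leftrightarrow y_0)=\inf_{\theta}\sum_{e\in E}r_e\theta(e)^2$, the infimum being over all flows $\theta$ from $x_0$ to $y_0$ of strength $1$. *)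

(* Defs.v *)
From HB Require Import structures.
From mathcomp Require Import all_boot all_order all_algebra.
From mathcomp Require Import all_classical all_reals all_analysis.
Set Implicit Arguments. Unset Strict Implicit. Unset Printing Implicit Defensive.
Import Order.TTheory GRing.Theory Num.Theory.
Local Open Scope classical_set_scope.
Local Open Scope ring_scope.

Definition vertex := (int * int)%type.

Definition vadd (x y : vertex) : vertex := (x.1 + y.1, x.2 + y.2).

Definition adj (x y : vertex) : bool :=
  (`|x.1 - y.1| + `|x.2 - y.2| == 1 :> int).

Definition nbrs (x : vertex) : seq vertex :=
  [:: vadd x (1, 0); vadd x (-1, 0); vadd x (0, 1); vadd x (0, -1)].

(* Unoriented edges of Z^2: the edge (x, true) is {x, x + e1},
   the edge (x, false) is {x, x + e2}.  This is a bijective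
   parametrisation of the set E of unoriented nearest-neighbour edges. *)
Definition edge := (vertex * bool)%type.
Definition etail (e : edge) : vertex := e.1.
Definition ehead (e : edge) : vertex :=
  vadd e.1 (if e.2 then (1, 0) else (0, 1)).

Section Resistance.
Variable R : realType.

Definition outflow (theta : vertex -> vertex -> R) (x : vertex) : R :=
  \sum_(y <- nbrs x) theta x y.

Definition unit_flow (x0 y0 : vertex) : set (vertex -> vertex -> R) :=
  [set theta | (forall x y, adj x y -> theta x y = - theta y x) /\
               (forall x, x != x0 -> x != y0 -> outflow theta x = 0) /\
               outflow theta x0 = 1 /\ outflow theta y0 = -1].

Definition energy (r : edge -> R) (theta : vertex -> vertex -> R) : \bar R :=
  \esum_(e in [set: edge]) ((r e * (theta (etail e) (ehead e)) ^+ 2)%:E).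

Definition eff_res_ext (r : edge -> R) (x0 y0 : vertex) : \bar R :=
  ereal_inf [set energy r theta | theta in unit_flow x0 y0].

(* real-valued version (the resistance is finite on Z^2) *)
Definition eff_res (r : edge -> R) (x0 y0 : vertex) : R :=
  fine (eff_res_ext r x0 y0).

Definition nu_mass (a b x : R) : R :=
  (if x == a then 1/2 else 0) + (if x == b then 1/2 else 0).

(* the resistances (r_e)_{e in E} are i.i.d. with law nu: every
   finite-dimensional distribution is the product of copies of nu *)
Definition iid_nu {d : measure_display} {T : measurableType d}
  (P : probability T R) (r : edge -> T -> R) (a b : R) : Prop :=
  forall (F : seq edge), uniq F -> forall x : edge -> R,
    P (\bigcap_(e in [set` F]) [set w | r e w = x e]) =
      (\prod_(e <- F) nu_mass a b (x e))%:E.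

End Resistance.

Definition l1norm (v : vertex) : nat := (`|v.1| + `|v.2|)%N.

(* Main.v *)
(**
  The energy minimising flow is controlled by a hole filling argument.  Around
  any point, a flow that is divergence free up to an explicit reference flow
  [g0] has a stream function; flattening the stream function across an annulus
  gives a competitor, so the energy in a ball of radius [K] is at most a fixed
  fraction of (energy in the ball of radius [2K]) + (energy of [g0]).  Away
  from the two poles ([g0 = 0]) the current through an edge thus decays like a
  power of the distance to the poles.  Near a pole, with [g0] the flow of
  Polya's urn, the energy in a ball of radius [2^j] is [O(j)].  Since the total
  energy is [O(log |v|)], splitting at [j ~ (log |v|)^(1/3)] gives
  [sum_e g(e)^4 = O((log |v|)^(2/3))] for every environment.  Changing one
  resistance from [a] to [b] changes the effective resistance by at most
  [(b - a) g(e)^2], so the Efron-Stein inequality yields the variance bound.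
  Existence of minimisers is avoided by working with flows whose energy is
  minimal up to [eps].
*)
Require Import Defs.
From HB Require Import structures.
From mathcomp Require Import all_boot all_order all_algebra.
From mathcomp Require Import all_classical all_reals all_analysis.
From mathcomp Require Import measurable_realfun zify ring lra.
Import Order.TTheory GRing.Theory Num.Theory numFieldNormedType.Exports.
Local Open Scope classical_set_scope.
Local Open Scope ring_scope.

Set Implicit Arguments.
Unset Strict Implicit.
Unset Printing Implicit Defensive.

(** * Boxes, curl and stream functions *)

(** A sum of fourth powers is at most the largest square times the energy. Within radius [2 ^ j] of
    a pole both are [O(j)], whence [j ^ 2]; farther out the square is of order [gam ^ j * log |v|]
    and the energy of order [log |v|]. With [j] of order [(log |v|)^(1/3)] the exponential beats
    every power of the logarithm, and [j ^ 2] alone gives the exponent [2/3]. A further obstacle is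
    that the effective resistance is an infimum over uncountably many flows and depends on
    infinitely many resistances. The resistances outside a box are therefore frozen at [b]: what
    remains is a function of finitely many two-valued coordinates, for which Efron-Stein is finite
    algebra. The bound is uniform in the box, so the variance passes to the limit on the event that
    all resistances are [a] or [b]. The error [eps] may depend on [v] and on the box, since it
    disappears from the final bound. *)

Definition sup_norm (x : vertex) : nat := maxn `|x.1|%N `|x.2|%N.

(* The dual vertex [x] is the centre of the face whose lower left corner is [x];
   the edge [e] separates the faces [e.1] and [dual e]. *)
Definition dual (e : edge) : vertex :=
  if e.2 then (e.1.1, e.1.2 - 1) else (e.1.1 - 1, e.1.2).

(** Radii are measured on the two faces beside the edge, so that a stream function on the faces of
    norm at most [K] determines the current exactly on [ball K]. *)
Definition rad (e : edge) : nat := maxn (sup_norm e.1) (sup_norm (dual e)).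

Definition int_range (K : nat) : seq int := [seq Posz i - Posz K | i <- iota 0 K.*2.+2].

Definition ball (K : nat) : seq edge :=
  [seq e <- [seq (x, t) | x <- [seq (i, j) | i <- int_range K, j <- int_range K],
                          t <- [:: true; false]] | (rad e <= K)%N].

Lemma int_range_uniq K : uniq (int_range K).
Proof. by rewrite map_inj_in_uniq ?iota_uniq // => i j _ _ /=; lia. Qed.

Lemma mem_int_range K (i : int) : (- K%:Z <= i <= K%:Z + 1) -> i \in int_range K.
Proof.
move=> H; apply/mapP; exists `|(i + K%:Z)%R|%N; last by lia.
by rewrite mem_iota; lia.
Qed.

Lemma size_int_range K : size (int_range K) = K.*2.+2.
Proof. by rewrite size_map size_iota. Qed.

Lemma ball_uniq K : uniq (ball K).
Proof.
apply: filter_uniq; apply: allpairs_uniq => //; last by move=> [? ?] [? ?].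
by apply: allpairs_uniq; rewrite ?int_range_uniq // => -[? ?] [? ?].
Qed.

Lemma mem_ball K e : (e \in ball K) = (rad e <= K)%N.
Proof.
rewrite mem_filter; case: (leqP (rad e) K) => // H; rewrite andTb; apply/allpairsPdep.
case: e H => -[x y] t; rewrite /rad /sup_norm /dual => H.
exists (x, y), t; split => //; last by case: t {H}.
by apply/allpairsPdep; exists x, y; split => //; apply: mem_int_range; case: t H => /=; lia.
Qed.

Lemma ball_card k : (0 < k)%N ->
  (count (fun e => rad e == k) (ball k) <= 64 * k)%N.
Proof.
move=> k0; rewrite -size_filter.
(* An edge of radius [k] has a coordinate in [cs], the shifted values coming from the face [dual e].
   The two lists have [32 * k + 32] entries in all, at most [64 * k] because [k] is positive. *)
pose cs : seq int := [:: k%:Z; - k%:Z; k%:Z + 1; 1 - k%:Z].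
pose l1 := [seq (x, t) | x <- [seq (c, j) | c <- cs, j <- int_range k], t <- [:: true; false]].
pose l2 := [seq (x, t) | x <- [seq (j, c) | c <- cs, j <- int_range k], t <- [:: true; false]].
have -> : (64 * k = (64 * k - size (l1 ++ l2)) + size (l1 ++ l2))%N.
  by rewrite subnK // size_cat !size_allpairs size_int_range /=; lia.
apply: leq_trans (leq_addl _ _).
apply: uniq_leq_size; first exact/filter_uniq/ball_uniq.
move=> [[x y] t]; rewrite mem_filter mem_ball => /andP[/eqP H _].
rewrite mem_cat; apply/orP; move: H; rewrite /rad /sup_norm /dual /= => H.
have : x \in cs \/ y \in cs by rewrite !inE; case: t H => /=; lia.
case => Hc; [left|right]; apply/allpairsPdep; exists (x, y), t; split => //; try by case: (t).
  by apply/allpairsPdep; exists x, y; split => //; apply: mem_int_range; case: t H => /=; lia.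
by apply/allpairsPdep; exists y, x; split => //; apply: mem_int_range; case: t H => /=; lia.
Qed.

Section Curl.
Variable R : realType.
Implicit Types (g : edge -> R) (psi : vertex -> R).

Definition curl psi (e : edge) : R :=
  if e.2 then psi e.1 - psi (dual e) else psi (dual e) - psi e.1.

Definition div g (x : vertex) : R :=
  g (x, true) - g ((x.1 - 1, x.2), true) + g (x, false) - g ((x.1, x.2 - 1), false).

Lemma curl_sqr psi e : curl psi e ^+ 2 = (psi e.1 - psi (dual e)) ^+ 2.
Proof. by rewrite /curl; case: e => x [] //=; rewrite -sqrrN opprB. Qed.

Lemma div_curl psi x : div (curl psi) x = 0.
Proof. by case: x => x y; rewrite /div /curl /dual /=; ring. Qed.

Lemma ler_sum_sub (T : eqType) (s t : seq T) (F : T -> R) :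
  uniq s -> uniq t -> {subset s <= t} -> (forall x, x \in t -> 0 <= F x) ->
  \sum_(x <- s) F x <= \sum_(x <- t) F x.
Proof.
move=> us ut st F0.
rewrite [leRHS](bigID (mem s)) /= -[leLHS]addr0.
have -> : \sum_(x <- s) F x = \sum_(x <- t | x \in s) F x.
  rewrite -[RHS]big_filter; apply: perm_big; apply: uniq_perm => //; first exact: filter_uniq.
  move=> x; rewrite mem_filter; case: (boolP (x \in s)) => //= /st ->; by [].
rewrite lerD2l big_seq_cond; apply: sumr_ge0 => x /andP[xt _]; exact: F0.
Qed.

(** This is Cauchy-Schwarz for [L] increments; the induction step comes down to
    [(A - l * d) ^+ 2 >= 0]. *)
Lemma telescope_sqr (f : nat -> R) (L : nat) :
  (f L - f 0%N) ^+ 2 <= L%:R * \sum_(i < L) (f i.+1 - f i) ^+ 2.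
Proof.
elim: L => [|L IH]; first by rewrite subrr expr0n mul0r.
rewrite big_ord_recr /=; set S := \sum_(i < L) _ in IH *.
case: L @S IH => [|L] S IH; first by rewrite /S big_ord0 add0r mul1r.
set d := f L.+2 - f L.+1; set A := f L.+1 - f 0%N in IH *.
have -> : f L.+2 - f 0%N = A + d by rewrite /A /d; ring.
have l0 : 0 < (L.+1)%:R :> R by rewrite ltr0Sn.
have -> : (L.+2)%:R = (L.+1)%:R + 1 :> R by rewrite -natr1.
move: IH l0; move: (L.+1)%:R => l IH l0.
rewrite -(ler_pM2l l0).
have : 0 <= (A - l * d) ^+ 2 by exact: sqr_ge0.
have : (l+1) * A ^+ 2 <= (l+1) * (l * S) by rewrite ler_wpM2l // ltW // ltr_wpDr.
nra.
Qed.

Definition ring_energy (k : nat) g : R := \sum_(e <- ball k | rad e == k) g e ^+ 2.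

Lemma ring_energy_ge0 k g : 0 <= ring_energy k g.
Proof. by apply: sumr_ge0 => e _; exact: sqr_ge0. Qed.

(** Meant for a side of the square of radius [k], a dual path of at most [2 * k] edges of ring [k].
    Injectivity of [E] makes the energy along the path a part of [ring_energy k]. *)
Lemma side_osc psi (k L : nat) (E : nat -> edge) (u : nat -> vertex) :
  (forall i, (i < L)%N -> (psi (u i.+1) - psi (u i)) ^+ 2 = curl psi (E i) ^+ 2) ->
  (forall i, (i < L)%N -> rad (E i) = k) -> injective E -> (L <= 2 * k)%N ->
  (psi (u 0%N) - psi (u L)) ^+ 2 <= 2 * k%:R * ring_energy k (curl psi).
Proof.
move=> Eu Er Ei Lk.
rewrite -sqrrN opprB; apply: le_trans (telescope_sqr (fun i => psi (u i)) L) _.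
apply: ler_pM => //; first by apply: sumr_ge0 => i _; exact: sqr_ge0.
  by rewrite -natrM ler_nat.
rewrite (eq_bigr (fun i : 'I_L => curl psi (E i) ^+ 2)); last by move=> i _; exact: Eu.
rewrite -(big_mkord xpredT (fun i => curl psi (E i) ^+ 2)) -(big_map E xpredT (fun e => curl psi e ^+ 2)).
rewrite /ring_energy -[leRHS]big_filter; apply: ler_sum_sub => //.
- by rewrite map_inj_uniq // /index_iota iota_uniq.
- exact/filter_uniq/ball_uniq.
- move=> e /mapP[i]; rewrite mem_index_iota => /andP[_ iL] ->.
  by rewrite mem_filter mem_ball Er // eqxx leqnn.
- by move=> e _; exact: sqr_ge0.
Qed.

(** At most two sides of the square lead from [x] to the corner, each with squared oscillation at
    most [2 * k] times the ring energy; [(u + v)^2 <= 2 u^2 + 2 v^2] gives [8 * k]. *)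
Lemma ring_osc psi (k : nat) x : sup_norm x = k ->
  (psi x - psi (k%:Z, k%:Z)) ^+ 2 <= 8 * k%:R * ring_energy k (curl psi).
Proof.
case: x => x y; rewrite /sup_norm /= => Nx.
set G := ring_energy k _.
have kG : 0 <= k%:R * G by rewrite mulr_ge0 // ring_energy_ge0.
have vert (c : int) (y0 : int) : `|c|%N = k -> (`|y0| <= k)%N ->
    (psi (c, y0) - psi (c, k%:Z)) ^+ 2 <= 2 * k%:R * G.
  move=> ck yk.
  have := @side_osc psi k `|(k%:Z - y0)%R|%N (fun i => ((c, y0 + i%:Z + 1), true))
     (fun i => (c, y0 + i%:Z)).
  rewrite addr0 (_ : y0 + _ = k%:Z); last lia.
  apply.
  - move=> i _; rewrite curl_sqr /dual /= (_ : y0 + Posz i.+1 = y0 + i%:Z + 1); last lia.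
    by rewrite addrK.
  - by move=> i; rewrite /rad /sup_norm /dual /=; lia.
  - by move=> i j []; lia.
  - lia.
have horz (c : int) (x0 : int) : `|c|%N = k -> (`|x0| <= k)%N ->
    (psi (x0, c) - psi (k%:Z, c)) ^+ 2 <= 2 * k%:R * G.
  move=> ck xk.
  have := @side_osc psi k `|(k%:Z - x0)%R|%N (fun i => ((x0 + i%:Z + 1, c), false))
     (fun i => (x0 + i%:Z, c)).
  rewrite addr0 (_ : x0 + _ = k%:Z); last lia.
  apply.
  - move=> i _; rewrite curl_sqr /dual /= (_ : x0 + Posz i.+1 = x0 + i%:Z + 1); last lia.
    by rewrite addrK.
  - by move=> i; rewrite /rad /sup_norm /dual /=; lia.
  - by move=> i j []; lia.
  - lia.
have two (A B C : R) : (A - B) ^+ 2 <= 2 * k%:R * G -> (B - C) ^+ 2 <= 2 * k%:R * G ->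
    (A - C) ^+ 2 <= 8 * k%:R * G.
  move=> h1 h2; have : 0 <= (A - B - (B - C)) ^+ 2 by exact: sqr_ge0.
  nra.
case: (eqVneq `|x|%N k) => [xk|xk].
  apply: (two _ (psi (x, k%:Z))); first by apply: vert => //; lia.
  by apply: horz; lia.
apply: (two _ (psi (k%:Z, y))); first by apply: horz; lia.
by apply: vert; lia.
Qed.

Fixpoint nat_prim (f : nat -> R) (n : nat) : R :=
  if n is m.+1 then nat_prim f m + f m else 0.

Definition int_prim (f : int -> R) (n : int) : R :=
  match n with
  | Posz m => nat_prim (fun i => f (i%:Z + 1)) m
  | Negz m => - nat_prim (fun i => f (- i%:Z)) m.+1
  end.

Lemma int_primB (f : int -> R) (n : int) : int_prim f n - int_prim f (n - 1) = f n.
Proof.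
case: n => [[|n]|n].
- by rewrite (_ : Posz 0 - 1 = Negz 0) //= !add0r opprK.
- rewrite (_ : Posz n.+1 - 1 = n%:Z); last lia.
  by rewrite /= addrC addKr; congr f; lia.
- rewrite (_ : Negz n - 1 = Negz n.+1); last lia.
  by rewrite /= (_ : Negz n = - (Posz n.+1)); [ring|lia].
Qed.

(* On a box where [q] is divergence free, path integration of [q] along
   L-shaped paths from the centre is a stream function. *)
Lemma stream_function (q : edge -> R) (M : nat) :
  (forall x, (sup_norm x <= M)%N -> div q x = 0) ->
  exists psi : vertex -> R, forall e, (rad e <= M)%N -> curl psi e = q e.
Proof.
move=> dq.
pose psi (x : vertex) := - int_prim (fun i => q ((i, 0), false)) x.1
   + int_prim (fun j => q ((x.1, j), true)) x.2.
exists psi => -[[x y] t]; rewrite /rad /sup_norm /dual /=.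
case: t => /= H.
  rewrite /curl /dual /psi /= -(int_primB (fun j => q ((x, j), true)) y); ring.
(* [c] compares the integrals along two neighbouring columns, corrected by the current between them.
   Its increment at [z] is the divergence at [(x, z)], so it keeps its value at [0], which is the
   current used in the first leg of [psi]. *)
pose c (z : int) := int_prim (fun j => q ((x, j), true)) z -
  int_prim (fun j => q ((x - 1, j), true)) z + q ((x, z), false).
have cB z : (`|z| <= M)%N -> c z = c (z - 1).
  move=> zM; apply/eqP; rewrite -subr_eq0; apply/eqP.
  have := dq (x, z); rewrite /div /sup_norm /= => <-; last lia.
  rewrite -(int_primB (fun j => q ((x, j), true)) z) -(int_primB (fun j => q ((x - 1, j), true)) z).
  rewrite /c; ring.
have c0 : c y = c 0.
  have pos (m : nat) : (m <= M)%N -> c m%:Z = c 0.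
    elim: m => // m IH mM; rewrite cB; last lia.
    by rewrite (_ : Posz m.+1 - 1 = m%:Z); [apply: IH; lia | lia].
  have neg (m : nat) : (m <= M)%N -> c (- m%:Z) = c 0.
    elim: m => [|m IH] mM; first by rewrite oppr0.
    rewrite -IH; last lia.
    by rewrite [RHS]cB; [congr c; lia | lia].
  case: y H => m H; first by apply: pos; lia.
  by rewrite NegzE; apply: neg; lia.
rewrite /curl /dual /psi /=.
have := int_primB (fun i => q ((i, 0), false)) x.
move: c0; rewrite /c /= => c0 Hx.
by rewrite -[RHS](addrK (int_prim (fun j => q ((x, j), true)) y -
  int_prim (fun j => q ((x - 1, j), true)) y)) [q ((x, y), false) + _]addrC c0 -Hx; ring.
Qed.

End Curl.

(** * Hole filling *)

Section HoleFilling.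
Variable R : realType.
Implicit Types (g : edge -> R) (psi : vertex -> R).

Definition sq_energy (K : nat) g : R := \sum_(e <- ball K) g e ^+ 2.

Lemma sq_energy_ge0 K g : 0 <= sq_energy K g.
Proof. by apply: sumr_ge0 => e _; exact: sqr_ge0. Qed.

Lemma ball_sub K L : (K <= L)%N -> {subset ball K <= ball L}.
Proof. by move=> KL e; rewrite !mem_ball => /leq_trans; apply. Qed.

Lemma sum_ball_restrict K L (F : edge -> R) : (K <= L)%N ->
  \sum_(e <- ball L | (rad e <= K)%N) F e = \sum_(e <- ball K) F e.
Proof.
move=> KL; rewrite -big_filter; apply: perm_big; apply: uniq_perm.
- exact/filter_uniq/ball_uniq.
- exact: ball_uniq.
move=> e; rewrite mem_filter !mem_ball.
by case: leqP => // H; rewrite (leq_trans H).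
Qed.

Lemma sum_ball_split K L (F : edge -> R) : (K <= L)%N ->
  \sum_(e <- ball L) F e = \sum_(e <- ball K) F e + \sum_(e <- ball L | (K < rad e)%N) F e.
Proof.
move=> KL; rewrite (bigID (fun e => rad e <= K)%N) /= sum_ball_restrict //.
by congr (_ + _); apply: eq_bigl => e; rewrite -ltnNge.
Qed.

Definition cutoff (K k : nat) : R := (minn (k - K) K)%:R / K%:R.

Lemma cutoff_bounds K k : 0 <= cutoff K k <= 1.
Proof.
rewrite divr_ge0 ?ler0n //=; case: K => [|K]; first by rewrite /cutoff invr0 mulr0.
by rewrite ler_pdivrMr ?ltr0n // mul1r ler_nat geq_minr.
Qed.

Lemma cutoffS K k : 0 <= cutoff K k.+1 - cutoff K k <= K%:R^-1.
Proof.
rewrite /cutoff -mulrBl -natrB; last lia.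
rewrite divr_ge0 ?ler0n //= ler_piMl ?invr_ge0 ?ler0n //.
by rewrite -[1]/(1%:R) ler_nat; lia.
Qed.

Lemma cutoff0 K k : (k <= K)%N -> cutoff K k = 0.
Proof. by move=> kK; rewrite /cutoff (_ : minn _ _ = 0%N) ?mul0r //; lia. Qed.

Lemma cutoff1 K k : (0 < K)%N -> (2 * K <= k)%N -> cutoff K k = 1.
Proof.
by move=> K0 kK; rewrite /cutoff (_ : minn _ _ = K) ?divff ?pnatr_eq0 //; lia.
Qed.

Definition diag psi (k : nat) : R := psi (k%:Z, k%:Z).

Definition level K psi (k : nat) : R :=
  diag psi (2 * K) -
  \sum_(k <= i < 2 * K) cutoff K i * (diag psi i.+1 - diag psi i).

(* Between the radii [2K] and [K] the stream function is flattened ring by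
   ring towards its value at the corner of the ring; the levels are chosen so
   that the flattening of neighbouring rings does not create any jump. *)
Definition flatten_stream K psi (x : vertex) : R :=
  level K psi (sup_norm x) +
  cutoff K (sup_norm x) * (psi x - diag psi (sup_norm x)).

Lemma levelS K psi k : (k < 2 * K)%N ->
  level K psi k.+1 - level K psi k = cutoff K k * (diag psi k.+1 - diag psi k).
Proof. by move=> kK; rewrite /level [in X in _ - X](big_ltn kK); ring. Qed.

Lemma flatten_stream_outer K psi x : (0 < K)%N -> sup_norm x = (2 * K)%N ->
  flatten_stream K psi x = psi x.
Proof.
move=> K0 xK; rewrite /flatten_stream xK cutoff1 // /level big_geq // subr0; ring.
Qed.

(** The drift of the corner values cancels against the increment of [level]. What remains is the
    oscillation inside one ring, damped by the slope of the cutoff, so that [ring_osc] on a single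
    ring suffices. *)
Lemma flatten_stream_step K psi (k : nat) u w : (k < 2 * K)%N ->
  sup_norm u = k -> sup_norm w = k.+1 ->
  flatten_stream K psi w - flatten_stream K psi u =
  (cutoff K k.+1 - cutoff K k) * (psi w - diag psi k.+1) + cutoff K k * (psi w - psi u).
Proof.
move=> kK uk wk; rewrite /flatten_stream uk wk.
have -> : level K psi k.+1 = level K psi k + cutoff K k * (diag psi k.+1 - diag psi k).
  by rewrite -levelS // addrC subrK.
ring.
Qed.

Lemma flatten_stream_pair K psi (k : nat) u w : (0 < K)%N -> (k <= 2 * K)%N ->
  sup_norm w = k -> (sup_norm u <= k)%N -> (k <= (sup_norm u).+1)%N ->
  (flatten_stream K psi w - flatten_stream K psi u) ^+ 2 <=
  if (k <= K)%N then 0 else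
  2 * (psi w - psi u) ^+ 2 + 32 / K%:R * ring_energy k (curl psi).
Proof.
move=> K0 kK wk uk1 uk2.
have K0R : 0 < K%:R :> R by rewrite ltr0n.
have G0 := @ring_energy_ge0 _ k (curl psi).
have G1 : 0 <= 32 / K%:R * ring_energy k (curl psi) by rewrite mulr_ge0 // divr_ge0.
have [uk|uk] : sup_norm u = k \/ (sup_norm u).+1 = k by lia.
  rewrite /flatten_stream uk wk.
  rewrite (_ : _ - _ = cutoff K k * (psi w - psi u)); last by ring.
  case: leqP => kK'; first by rewrite cutoff0 // mul0r expr0n.
  have /andP[c0 c1] := cutoff_bounds K k.
  rewrite exprMn; apply: (@le_trans _ _ ((psi w - psi u) ^+ 2)).
    by rewrite ler_piMl ?sqr_ge0 // exprn_ile1.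
  by have := sqr_ge0 (psi w - psi u); lra.
case: k => // k in wk uk1 uk2 uk kK G0 G1 *; case: uk => uk.
rewrite (@flatten_stream_step K psi k) //.
case: ifP => kK'.
  have -> : cutoff K k = 0 by apply: cutoff0; lia.
  by rewrite cutoff0 // subrr !mul0r addr0 expr0n.
have /andP[c0 c1] := cutoff_bounds K k.
have /andP[d0 d1] := cutoffS K k.
have osc := ring_osc psi wk.
rewrite /diag; set d := _ - cutoff K k in d0 d1 *; set c := cutoff K k in c0 c1 *.
set p := psi w - psi (_, _) in osc *; set t := psi w - psi u.
have h1 : (d * p + c * t) ^+ 2 <= 2 * (d * p) ^+ 2 + 2 * (c * t) ^+ 2.
  by have := sqr_ge0 (d * p - c * t); nra.
have h2 : (c * t) ^+ 2 <= t ^+ 2.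
  by rewrite exprMn ler_piMl ?sqr_ge0 // exprn_ile1.
(* The squared slope is at most [1 / K ^ 2] and the ring bound at most [8 * (2 * K)] times the ring
   energy; the doubling in [h1] then gives [32 / K]. *)
have h3 : (d * p) ^+ 2 <= 16 / K%:R * ring_energy k.+1 (curl psi).
  rewrite exprMn; apply: le_trans (_ : K%:R^-1 ^+ 2 * (8 * (2 * K%:R) * ring_energy k.+1 (curl psi)) <= _).
    apply: ler_pM; rewrite ?sqr_ge0 //; first by rewrite lerXn2r ?nnegrE ?invr_ge0 // ltW.
    apply: le_trans osc _; apply: ler_wpM2r => //; apply: ler_wpM2l => //.
    by rewrite -natrM ler_nat.
  rewrite le_eqVlt; apply/orP; left; apply/eqP; field.
  by rewrite gt_eqF.
lra.
Qed.

(** [w] is the outer face, which realises the radius; the two faces differ by a unit step, so the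
    inner one loses at most one. *)
Lemma rad_pair e : exists u w, [/\ (u = e.1 /\ w = dual e) \/ (w = e.1 /\ u = dual e),
  sup_norm w = rad e, (sup_norm u <= rad e)%N & (rad e <= (sup_norm u).+1)%N].
Proof.
case: e => -[x y] []; rewrite /rad /sup_norm /dual /=.
  case: (leqP (maxn `|x| `|y|) (maxn `|x| `|(y - 1)%R|)) => H;
    [exists (x, y), (x, y - 1)|exists (x, y - 1), (x, y)];
    by split => /=; [tauto|lia|lia|lia].
case: (leqP (maxn `|x| `|y|) (maxn `|(x - 1)%R| `|y|)) => H;
  [exists (x, y), (x - 1, y)|exists (x - 1, y), (x, y)];
  by split => /=; [tauto|lia|lia|lia].
Qed.

Lemma flatten_stream_edge K psi e : (0 < K)%N -> (rad e <= 2 * K)%N ->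
  curl (flatten_stream K psi) e ^+ 2 <=
  if (rad e <= K)%N then 0 else
  2 * curl psi e ^+ 2 + 32 / K%:R * ring_energy (rad e) (curl psi).
Proof.
move=> K0 eK; rewrite !curl_sqr.
have [u [w [uw wk uk1 uk2]]] := rad_pair e.
have := @flatten_stream_pair K psi _ u w K0 eK wk uk1 uk2.
by case: uw => -[-> ->] //; rewrite -sqrrN opprB -[(psi e.1 - _) ^+ 2]sqrrN opprB.
Qed.

(** After exchanging the sums, each edge is counted once for every edge of its ring, at most
    [64 * (2 * K)] times by [ball_card]. This factor [K] compensates the [1 / K] of the
    flattening. *)
Lemma sum_ring_energy (K : nat) g : (0 < K)%N ->
  \sum_(e <- ball (2 * K) | (K < rad e)%N) ring_energy (rad e) g <=
  128 * K%:R * \sum_(e <- ball (2 * K) | (K < rad e)%N) g e ^+ 2.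
Proof.
move=> K0.
have ringE e : (rad e <= 2 * K)%N -> ring_energy (rad e) g =
    \sum_(f <- ball (2 * K)) if rad f == rad e then g f ^+ 2 else 0.
  move=> eK; rewrite -big_mkcond /= /ring_energy.
  rewrite -[LHS]big_filter -[RHS]big_filter; apply: perm_big; apply: uniq_perm.
  - exact/filter_uniq/ball_uniq.
  - exact/filter_uniq/ball_uniq.
  by move=> f; rewrite mem_filter [RHS]mem_filter !mem_ball; case: eqP => //= ->; rewrite leqnn eK.
rewrite big_seq_cond (eq_bigr (fun e =>
    \sum_(f <- ball (2 * K)) if rad f == rad e then g f ^+ 2 else 0)); last first.
  by move=> e; rewrite mem_ball => /andP[eK _]; exact: ringE.
rewrite -big_seq_cond exchange_big /= big_distrr /= [leRHS]big_mkcond /=.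
rewrite big_seq [leRHS]big_seq; apply: ler_sum => f; rewrite mem_ball => fK.
rewrite -big_mkcondr /= big_const_seq iter_addr_0.
case: ifP => Kf; last first.
  rewrite (@eq_count _ _ pred0) ?count_pred0 ?mulr0n // => e /=.
  by case: eqP => [<-|]; rewrite ?Kf ?andbF.
rewrite -[leLHS]mulr_natl; apply: ler_wpM2r; first exact: sqr_ge0.
rewrite -natrM ler_nat.
apply: (@leq_trans (64 * rad f)); last lia.
apply: leq_trans (ball_card (_ : 0 < rad f)%N); last lia.
rewrite -!size_filter; apply: uniq_leq_size; first exact/filter_uniq/ball_uniq.
move=> e; rewrite mem_filter => /andP[/andP[_ /eqP fe] _].
by rewrite mem_filter mem_ball -fe eqxx leqnn.
Qed.

Definition flat_const : R := 2 + 32 * 128.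

Lemma flat_const_ge0 : 0 <= flat_const.
Proof. by rewrite addr_ge0 // mulr_ge0. Qed.

Lemma flatten_stream_energy K psi : (0 < K)%N ->
  sq_energy (2 * K) (curl (flatten_stream K psi)) <=
  flat_const * \sum_(e <- ball (2 * K) | (K < rad e)%N) curl psi e ^+ 2.
Proof.
move=> K0; have K0R : 0 < K%:R :> R by rewrite ltr0n.
rewrite /sq_energy (@sum_ball_split K) //; last lia.
have -> : \sum_(e <- ball K) curl (flatten_stream K psi) e ^+ 2 = 0.
  rewrite big_seq big1 // => e; rewrite mem_ball => eK; apply/eqP.
  rewrite eq_le sqr_ge0 andbT; have := @flatten_stream_edge K psi e K0.
  by rewrite eK; apply; lia.
rewrite add0r; set S := \sum_(e <- _ | _) curl psi e ^+ 2.
apply: le_trans (_ : \sum_(e <- ball (2 * K) | (K < rad e)%N)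
   (2 * curl psi e ^+ 2 + 32 / K%:R * ring_energy (rad e) (curl psi)) <= _).
  rewrite big_seq_cond [leRHS]big_seq_cond; apply: ler_sum => e /andP[]; rewrite mem_ball => eK Ke.
  by have := @flatten_stream_edge K psi e K0 eK; rewrite leqNgt Ke.
rewrite big_split /= -!big_distrr /= -/S.
have := @sum_ring_energy K (curl psi) K0; rewrite -/S => H.
apply: (@le_trans _ _ (2 * S + 32 / K%:R * (128 * K%:R * S))).
  by rewrite lerD2l ler_wpM2l // divr_ge0 // ltW.
rewrite (_ : 32 / K%:R * _ = 32 * 128 * S); first by rewrite -mulrDl.
by rewrite -!mulrA; congr (_ * _); rewrite mulrCA; congr (_ * _); rewrite mulKf // gt_eqF.
Qed.

(** In the box [g - g0] is the curl of some [psi]; flattening [psi] yields the competitor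
    [g0 + curl (flatten_stream K psi)], whose second term vanishes on [ball K]. Hence the energy of
    the whole box is controlled by that of the annulus and that of [g0]. *)
Lemma hole_filling_raw (a b : R) (r g g0 : edge -> R) (K : nat) (eps : R) :
  0 < a -> a <= b -> (0 < K)%N -> 0 <= eps ->
  (forall e, a <= r e <= b) ->
  (forall x, (sup_norm x <= 2 * K)%N -> div g x = div g0 x) ->
  (forall chi, (forall x, (2 * K <= sup_norm x)%N -> chi x = 0) ->
     \sum_(e <- ball (2 * K)) r e * g e ^+ 2 <=
     \sum_(e <- ball (2 * K)) r e * (g e + curl chi e) ^+ 2 + eps) ->
  a * sq_energy (2 * K) g <= eps + b * ((4 * flat_const + 2) * sq_energy (2 * K) g0 +
    4 * flat_const * (sq_energy (2 * K) g - sq_energy K g)).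
Proof.
move=> a0 ab K0 eps0 rab dg near.
have dq x : (sup_norm x <= 2 * K)%N -> div (fun e => g e - g0 e) x = 0.
  move=> xK; transitivity (div g x - div g0 x); first by rewrite /div; ring.
  by rewrite dg // subrr.
have [psi psiE] := stream_function dq.
(* Flattening leaves [psi] unchanged at radius [2 * K], so cutting the correction off there creates
   no jump. *)
pose chi x := if (sup_norm x < 2 * K)%N then flatten_stream K psi x - psi x else 0.
have chiE x : (sup_norm x <= 2 * K)%N -> chi x = flatten_stream K psi x - psi x.
  rewrite /chi; case: ltngtP => // xK _.
  by rewrite flatten_stream_outer // subrr.
have gE e : e \in ball (2 * K) -> g e + curl chi e = g0 e + curl (flatten_stream K psi) e.
  rewrite mem_ball => eK; apply: (@addIr _ (- g0 e)); rewrite [LHS]addrAC -psiE //.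
  have [k1 k2] : (sup_norm e.1 <= 2 * K)%N /\ (sup_norm (dual e) <= 2 * K)%N.
    by apply/andP; rewrite -geq_max.
  by rewrite /curl !chiE //; case: ifP => _; ring.
have b0 : 0 < b by exact: lt_le_trans ab.
have h1 : a * sq_energy (2 * K) g <= \sum_(e <- ball (2 * K)) r e * g e ^+ 2.
  rewrite /sq_energy big_distrr /=; apply: ler_sum => e _.
  by apply: ler_wpM2r; [exact: sqr_ge0 | case/andP: (rab e)].
set D := \sum_(e <- ball (2 * K) | (K < rad e)%N) curl psi e ^+ 2.
have h2 : \sum_(e <- ball (2 * K)) r e * (g e + curl chi e) ^+ 2 <=
   b * (2 * sq_energy (2 * K) g0 + 2 * (flat_const * D)).
  apply: (@le_trans _ _ (b * \sum_(e <- ball (2 * K))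
     (2 * g0 e ^+ 2 + 2 * curl (flatten_stream K psi) e ^+ 2))).
    rewrite big_distrr /= big_seq [leRHS]big_seq; apply: ler_sum => e eK.
    have /andP[ra rb] := rab e; rewrite gE //.
    apply: ler_pM; rewrite ?sqr_ge0 //; first exact: le_trans (ltW a0) ra.
    by have := sqr_ge0 (g0 e - curl (flatten_stream K psi) e); nra.
  rewrite ler_pM2l // big_split /= -!big_distrr /= lerD2l ler_pM2l //.
  exact: flatten_stream_energy.
have h3 : D <= 2 * (sq_energy (2 * K) g - sq_energy K g) + 2 * sq_energy (2 * K) g0.
  have KK : (K <= 2 * K)%N by lia.
  have splt f : sq_energy (2 * K) f - sq_energy K f =
      \sum_(e <- ball (2 * K) | (K < rad e)%N) f e ^+ 2.
    by rewrite /sq_energy (sum_ball_split _ KK) addrAC subrr add0r.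
  apply: (@le_trans _ _ (2 * (sq_energy (2 * K) g - sq_energy K g) +
      2 * (sq_energy (2 * K) g0 - sq_energy K g0))); last first.
    by rewrite lerD2l ler_pM2l // lerBlDr lerDl sq_energy_ge0.
  rewrite !splt !big_distrr /= -big_split /= /D big_seq_cond [leRHS]big_seq_cond.
  apply: ler_sum => e /andP[]; rewrite mem_ball => eK _; rewrite psiE //.
  by have := sqr_ge0 (g e + g0 e); nra.
have chi0 x : (2 * K <= sup_norm x)%N -> chi x = 0 by move=> xK; rewrite /chi ltnNge xK.
have {}near := near chi chi0.
apply: le_trans h1 _; apply: le_trans near _; rewrite addrC lerD2l.
apply: le_trans h2 _; rewrite ler_pM2l //.
have := ler_wpM2l flat_const_ge0 h3; move: flat_const => c h4.
lra.
Qed.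

(** Widman's trick: add [C * B] to both sides of [A <= C * (A - B + A0 + eps)] and use [B <= A]. The
    contraction factor [C / (1 + C)] depends on [a] and [b] only. *)
Lemma hole_filling (a b : R) : 0 < a -> a <= b ->
  exists gam : R, 0 < gam < 1 /\
  forall (r g g0 : edge -> R) (K : nat) (eps : R),
  (0 < K)%N -> 0 <= eps ->
  (forall e, a <= r e <= b) ->
  (forall x, (sup_norm x <= 2 * K)%N -> div g x = div g0 x) ->
  (forall chi, (forall x, (2 * K <= sup_norm x)%N -> chi x = 0) ->
     \sum_(e <- ball (2 * K)) r e * g e ^+ 2 <=
     \sum_(e <- ball (2 * K)) r e * (g e + curl chi e) ^+ 2 + eps) ->
  sq_energy K g <= gam * (sq_energy (2 * K) g + sq_energy (2 * K) g0 + eps).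
Proof.
move=> a0 ab; have b0 : 0 < b by exact: lt_le_trans ab.
have c0 := flat_const_ge0; set c := flat_const in c0.
pose C := ((4 * c + 2) * b + 1) / a.
have C0 : 0 < C by rewrite divr_gt0 // ltr_wpDl // mulr_ge0 ?addr_ge0 ?mulr_ge0 // ltW.
exists (C / (1 + C)); split.
  by rewrite divr_gt0 ?addr_gt0 //= ltr_pdivrMr ?addr_gt0 // mul1r ltrDr.
move=> r g g0 K eps K0 e0 rab dg near.
have := hole_filling_raw a0 ab K0 e0 rab dg near.
set A := sq_energy (2 * K) g; set B := sq_energy K g; set A0 := sq_energy (2 * K) g0 => H.
have BA : B <= A.
  apply: ler_sum_sub; rewrite ?ball_uniq //; first by apply: ball_sub; lia.
  by move=> e _; exact: sqr_ge0.
have A00 : 0 <= A0 by exact: sq_energy_ge0.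
have : A <= C * (A - B + A0 + eps).
  rewrite -(ler_pM2l a0); apply: le_trans H _; rewrite -/c.
  have -> : a * (C * (A - B + A0 + eps)) = ((4 * c + 2) * b + 1) * (A - B + A0 + eps).
    by rewrite mulrA; congr (_ * _); rewrite /C mulrC divfK // gt_eqF.
  have h1 : 0 <= (4 * c + 2) * b * eps by rewrite !mulr_ge0 ?addr_ge0 ?mulr_ge0 // ltW.
  have h2 : 0 <= b * (A - B) by rewrite mulr_ge0 ?subr_ge0 // ltW.
  lra.
move=> H2; rewrite mulrAC ler_pdivlMr ?addr_gt0 //.
lra.
Qed.

End HoleFilling.

(** * Explicit flows *)

Section Flows.
Variable R : realType.
Implicit Types (g : edge -> R).

Definition is_flow (x y : vertex) g : Prop :=
  forall z, div g z = (z == x)%:R - (z == y)%:R.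

(** Bounding all finite partial sums keeps infinite sums out of the argument until [esum_leP]. *)
Definition sq_bounded g (c : R) : Prop :=
  forall s, uniq s -> \sum_(e <- s) g e ^+ 2 <= c.

Definition sq_flow (x y : vertex) (c : R) : Prop :=
  exists g, is_flow x y g /\ sq_bounded g c.

Lemma sq_bounded_ge0 g c : sq_bounded g c -> 0 <= c.
Proof. by move=> /(_ [::] isT); rewrite big_nil. Qed.

Lemma sq_boundedD g g' c c' : sq_bounded g c -> sq_bounded g' c' ->
  sq_bounded (fun e => g e + g' e) (2 * c + 2 * c').
Proof.
move=> gc gc' s us; apply: (@le_trans _ _ (\sum_(e <- s) (2 * g e ^+ 2 + 2 * g' e ^+ 2))).
  by apply: ler_sum => e _; have := sqr_ge0 (g e - g' e); nra.
by rewrite big_split /= -!big_distrr /= lerD // ler_pM2l ?gc ?gc'.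
Qed.

Lemma sq_bounded_transport (phi : edge -> edge) g g' c : injective phi ->
  (forall e, g' e ^+ 2 = g (phi e) ^+ 2) -> sq_bounded g c -> sq_bounded g' c.
Proof.
move=> phi_inj gg' gc s us; have := gc [seq phi e | e <- s].
by rewrite map_inj_uniq // big_map => /(_ us); under eq_bigr do rewrite -gg'.
Qed.

Lemma sq_flow_refl x : sq_flow x x 0.
Proof.
exists (fun=> 0); split; first by move=> z; rewrite /div; ring.
by move=> s us; rewrite big1 // => e _; rewrite expr0n.
Qed.

Lemma sq_flow_trans x y z c c' : sq_flow x y c -> sq_flow y z c' -> sq_flow x z (2 * c + 2 * c').
Proof.
move=> [g [fg gc]] [g' [fg' gc']]; exists (fun e => g e + g' e); split; last exact: sq_boundedD.
move=> w; transitivity (div g w + div g' w); first by rewrite /div; ring.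
by rewrite fg fg'; ring.
Qed.

Lemma sq_flow_sym x y c : sq_flow x y c -> sq_flow y x c.
Proof.
move=> [g [fg gc]]; exists (fun e => - g e); split; last first.
  by apply: (@sq_bounded_transport id g) => // e; rewrite sqrrN.
move=> w; transitivity (- div g w); first by rewrite /div; ring.
by rewrite fg; ring.
Qed.

Lemma sq_flow_shift (p x y : vertex) c :
  sq_flow x y c -> sq_flow (vadd p x) (vadd p y) c.
Proof.
move=> [g [fg gc]].
exists (fun e => g ((e.1.1 - p.1, e.1.2 - p.2), e.2)); split; last first.
  apply: (@sq_bounded_transport (fun e => ((e.1.1 - p.1, e.1.2 - p.2), e.2)) g) => //.
  by move=> [[e1 e2] t] [[f1 f2] t'] /= [] /addIr -> /addIr -> ->.
move=> [z1 z2]; transitivity (div g (z1 - p.1, z2 - p.2)).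
  by rewrite /div /=; congr (_ - g (_, _) + _ - g (_, _)); congr pair; ring.
rewrite fg; case: x y p {fg gc g} => [x1 x2] [y1 y2] [p1 p2]; rewrite /vadd /= -!pair_eqE /pair_eq /=.
by congr ((nat_of_bool _)%:R - (nat_of_bool _)%:R); lia.
Qed.

(** Reflection in the horizontal axis: vertical edges are reversed, hence the sign, and their lower
    endpoint changes, hence the [- 1]. *)
Lemma sq_flow_mirror (p : int) c : sq_flow (0, 0) (p, p) c -> sq_flow (0, 0) (p, - p) c.
Proof.
move=> [g [fg gc]].
exists (fun e => if e.2 then g ((e.1.1, - e.1.2), true) else - g ((e.1.1, - e.1.2 - 1), false)).
split; last first.
  apply: (@sq_bounded_transport (fun e => if e.2 then ((e.1.1, - e.1.2), true)
    else ((e.1.1, - e.1.2 - 1), false)) g) => //; last by move=> [x []] //=; rewrite sqrrN.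
  move=> [[e1 e2] []] [[f1 f2] []] //= [] -> h; congr (_, _, _); lia.
move=> [z1 z2]; transitivity (div g (z1, - z2)).
  rewrite /div /=.
  by rewrite (_ : - (z2 - 1) - 1 = - z2); [ring | lia].
rewrite fg -!pair_eqE /pair_eq /=.
by congr ((nat_of_bool _)%:R - (nat_of_bool _)%:R); lia.
Qed.

Lemma sq_flow_step (x : vertex) : sq_flow x (vadd x (1, 0)) 1.
Proof.
exists (fun e => (e == (x, true))%:R); split; last first.
  move=> s us; case: (boolP ((x, true) \in s)) => xs.
    rewrite (bigD1_seq _ xs us) /= eqxx expr1n big1 ?addr0 // => e /negPf ->.
    by rewrite expr0n.
  rewrite big_seq big1 // => e es; case: eqP => [ex|]; last by rewrite expr0n.
  by rewrite -ex es in xs.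
case: x => x1 x2 [z1 z2]; rewrite /div /vadd /= -!pair_eqE /pair_eq /= !andbT !andbF -!pair_eqE /pair_eq /=.
rewrite addr0 (_ : (z1 - 1 == x1) = (z1 == x1 + 1)); last lia.
by rewrite !addr0 subr0.
Qed.

(* The edge flow of Polya's urn: on the antidiagonal [i + j = s] of the first
   quadrant it carries the uniform mass [1 / (s + 1)] through each vertex. *)
Definition polya (e : edge) : R :=
  match e with
  | ((Posz i, Posz j), t) =>
      (if t then i.+1 else j.+1)%:R / ((i + j).+1%:R * (i + j).+2%:R)
  | _ => 0
  end.

Definition polya_trunc (m : nat) (e : edge) : R :=
  match e with
  | ((Posz i, Posz j), t) => if (i + j < m)%N then polya e else 0
  | _ => 0
  end.

(** [1 / (i + j + 1)] is the uniform law of the urn after [i + j] draws. It is both the mass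
    entering [(i, j)] and, in the next lemma, the mass leaving it: this is the node law for
    [polya]. *)
Lemma polya_in i j : (0 < i + j)%N ->
  i%:R / ((i + j)%:R * (i + j).+1%:R) + j%:R / ((i + j)%:R * (i + j).+1%:R)
  = (i + j).+1%:R^-1 :> R.
Proof.
move=> ij; rewrite -mulrDl -natrD invfM mulrA divff ?mul1r //.
by rewrite pnatr_eq0 -lt0n.
Qed.

Lemma polya_out i j :
  i.+1%:R / ((i + j).+1%:R * (i + j).+2%:R) + j.+1%:R / ((i + j).+1%:R * (i + j).+2%:R)
  = (i + j).+1%:R^-1 :> R.
Proof.
rewrite -mulrDl -natrD addSn addnS mulrC invfM -mulrA mulVf ?mulr1 //.
Qed.

Definition antidiag_mass (m : nat) (x : vertex) : R :=
  if (0 <= x.1) && (0 <= x.2) && (x.1 + x.2 == m%:Z) then m.+1%:R^-1 else 0.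

Lemma intS_sub1 (n : nat) : Posz n.+1 - 1 = n%:Z. Proof. lia. Qed.
Lemma int0_sub1 : Posz 0 - 1 = Negz 0. Proof. by []. Qed.
Lemma Negz_sub1 (n : nat) : Negz n - 1 = Negz n.+1. Proof. lia. Qed.

Lemma div_polya x : div polya x = (x == (0, 0))%:R.
Proof.
case: x => -[[|i]|i] [[|j]|j];
  rewrite /div /= ?intS_sub1 ?int0_sub1 ?Negz_sub1 /= ?subr0 ?addr0 -?pair_eqE /pair_eq /= ?andbF //.
- by rewrite !addn0 /=; lra.
- have := polya_out 0 j.+1; have := @polya_in 0 j.+1 isT.
  by rewrite !subn1 /= !add0n ?mul0r ?add0r => h1 h2; rewrite h2 -h1 subrr.
- have := polya_out i.+1 0; have := @polya_in i.+1 0 isT.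
  by rewrite !subn1 /= !addn0 ?mul0r ?addr0 => h1 h2; rewrite addrAC h2 -h1 subrr.
- have := polya_out i.+1 j.+1; have := @polya_in i.+1 j.+1 isT.
  by rewrite !subn1 /= !addnS !addSn => h1 h2; rewrite (addrAC _ (- _)) h2 -addrA -opprD h1 subrr.
Qed.

Lemma div_polya_trunc m x : (0 < m)%N ->
  div (polya_trunc m) x = (x == (0, 0))%:R - antidiag_mass m x.
Proof.
move=> m0; case: x => -[i|i] [j|j]; last 3 first.
- have -> : antidiag_mass m (Posz i, Negz j) = 0 by rewrite /antidiag_mass.
  rewrite /div /= ?Negz_sub1 -?pair_eqE /pair_eq /= andbF.
  by case: i => [|i]; rewrite ?int0_sub1 ?intS_sub1 /=; ring.
- have -> : antidiag_mass m (Negz i, Posz j) = 0 by rewrite /antidiag_mass.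
  by rewrite /div /= ?Negz_sub1 -?pair_eqE /pair_eq /=; ring.
- have -> : antidiag_mass m (Negz i, Negz j) = 0 by rewrite /antidiag_mass.
  by rewrite /div /= ?Negz_sub1 -?pair_eqE /pair_eq /=; ring.
rewrite -div_polya /antidiag_mass /= (_ : Posz i + Posz j == m = (i + j == m)%N); last by lia.
rewrite /div.
have E1 (k : nat) t : polya_trunc m (Posz k, Posz j, t) = if (k + j < m)%N then polya (Posz k, Posz j, t) else 0 by [].
(* Below the antidiagonal the truncation changes nothing at the vertex; beyond it all four edges
   vanish; on it the outgoing edges are removed, which leaves a sink of mass [1 / (m + 1)]. *)
case: (ltngtP (i + j) m) => ijm.
- have -> : polya_trunc m (Posz i - 1, Posz j, true) = polya (Posz i - 1, Posz j, true).
    by case: i ijm {E1} => [|i] ijm; rewrite ?int0_sub1 ?intS_sub1 //= (_ : (i + j < m)%N = true) //; lia.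
  have -> : polya_trunc m (Posz i, Posz j - 1, false) = polya (Posz i, Posz j - 1, false).
    by case: j ijm {E1} => [|j] ijm; rewrite ?int0_sub1 ?intS_sub1 //= (_ : (i + j < m)%N = true) //; lia.
  by rewrite /= ijm subr0.
- have -> : polya_trunc m (Posz i - 1, Posz j, true) = 0.
    by case: i ijm {E1} => [|i] ijm; rewrite ?int0_sub1 ?intS_sub1 //= (_ : (i + j < m)%N = false) //; lia.
  have -> : polya_trunc m (Posz i, Posz j - 1, false) = 0.
    by case: j ijm {E1} => [|j] ijm; rewrite ?int0_sub1 ?intS_sub1 //= (_ : (i + j < m)%N = false) //; lia.
  rewrite [X in X - 0 + _]/= [X in _ + X - 0]/= (_ : (i + j < m)%N = false); last lia.
  rewrite !subr0 addr0.
  have := div_polya (Posz i, Posz j); rewrite /div => ->.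
  by rewrite -pair_eqE /pair_eq /= (_ : (Posz i == 0) && _ = false) //; lia.
- have -> : polya_trunc m (Posz i - 1, Posz j, true) = polya (Posz i - 1, Posz j, true).
    by case: i ijm {E1} => [|i] ijm; rewrite ?int0_sub1 ?intS_sub1 //= (_ : (i + j < m)%N = true) //; lia.
  have -> : polya_trunc m (Posz i, Posz j - 1, false) = polya (Posz i, Posz j - 1, false).
    by case: j ijm {E1} => [|j] ijm; rewrite ?int0_sub1 ?intS_sub1 //= (_ : (i + j < m)%N = true) //; lia.
  have E2 t : polya_trunc m (Posz i, Posz j, t) = 0 by rewrite E1 ijm ltnn.
  have E3 : polya (Posz i, Posz j, true) + polya (Posz i, Posz j, false) = m.+1%:R^-1.
    by rewrite -ijm; exact: polya_out.
  rewrite !E2 -E3; cbn [fst snd]; ring.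
Qed.

Lemma antidiag_mass_sym m x : antidiag_mass m (m%:Z - x.1, m%:Z - x.2) = antidiag_mass m x.
Proof. by case: x => i j; rewrite /antidiag_mass /=; congr (if _ then _ else _); lia. Qed.

Lemma polya_le e : 0 <= polya e <= (rad e)%:R^-1.
Proof.
case: e => -[[i|i] [j|j]] t; rewrite /= ?invr_ge0 ?ler0n ?lexx //.
rewrite divr_ge0 ?mulr_ge0 ?ler0n //=.
apply: (@le_trans _ _ (i + j).+1%:R^-1).
  rewrite invfM mulrCA -[leRHS]mulr1; apply: ler_wpM2l; first by rewrite invr_ge0 ler0n.
  rewrite ler_pdivrMr ?ltr0n // mul1r ler_nat; case: t; lia.
rewrite lef_pV2 ?posrE ?ltr0n // ?ler_nat.
  by rewrite /rad /sup_norm /dual; case: t => /=; lia.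
by rewrite /rad /sup_norm /dual; case: t => /=; lia.
Qed.

Lemma size_ball K : (size (ball K) <= (K.*2.+2 * K.*2.+2) * 2)%N.
Proof.
rewrite size_filter; apply: leq_trans (count_size _ _) _.
by rewrite !size_allpairs !size_int_range.
Qed.

Lemma sum_le_card (T : Type) (s : seq T) (P : pred T) (F : T -> R) (c : R) :
  0 <= c -> (forall x, P x -> F x <= c) -> \sum_(x <- s | P x) F x <= (size s)%:R * c.
Proof.
move=> c0 Fc; elim: s => [|x s IH]; first by rewrite big_nil mul0r.
rewrite big_cons /= -natr1 mulrDl mul1r; case: ifP => Px.
  by rewrite addrC lerD // Fc.
by rewrite -[leLHS]addr0 lerD.
Qed.

(** Each dyadic annulus costs at most [72]: with [K = 2 ^ j], the ball of radius [2 * K] has at most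
    [2 (4 K + 2)^2 <= 72 K^2] edges, and outside [ball K] the flow is at most [1 / K]. *)
Lemma polya_energy j : sq_energy (2 ^ j) polya <= 72 * (j.+1)%:R.
Proof.
elim: j => [|j IH].
  apply: le_trans (sum_le_card (c := 1) _ _ _) _ => //.
    move=> e _; have /andP[h1 h2] := polya_le e; rewrite expr_le1 //.
    apply: le_trans h2 _; case: (rad e) => [|n]; first by rewrite invr0.
    by rewrite invf_le1 ?ltr0n // ler1n.
  rewrite !mulr1 -[72]/(72%:R) ler_nat; apply: leq_trans (size_ball _) _; by [].
rewrite expnS /sq_energy (@sum_ball_split _ (2 ^ j)); last lia.
have -> : j.+2%:R = j.+1%:R + 1 :> R by rewrite -natr1.
rewrite mulrDr lerD // mulr1.
set K := (2 ^ j)%N; have K0 : (0 < K)%N by rewrite expn_gt0.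
have c0 : 0 <= K%:R^-1 ^+ 2 :> R by exact: sqr_ge0.
apply: le_trans (sum_le_card _ c0 _) _.
  move=> e Ke; have /andP[h1 h2] := polya_le e.
  rewrite lerXn2r ?nnegrE ?invr_ge0 ?ler0n //; apply: le_trans h2 _.
  by rewrite lef_pV2 ?posrE ?ltr0n // ?ler_nat; lia.
rewrite exprVn ler_pdivrMr ?exprn_gt0 ?ltr0n // -natrX -natrM ler_nat.
by apply: leq_trans (size_ball _) _; nia.
Qed.

Lemma polya_trunc_bounded m J : (0 < m)%N -> (m <= 2 ^ J)%N ->
  sq_bounded (polya_trunc m) (72 * (J.+1)%:R).
Proof.
move=> m0 mJ s us; apply: le_trans (polya_energy J).
rewrite (bigID (fun e => polya_trunc m e == 0)) /= big1 ?add0r; last first.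
  by move=> e /eqP ->; rewrite expr0n.
rewrite -big_filter; apply: (@le_trans _ _ (\sum_(e <- s | polya_trunc m e != 0) polya e ^+ 2)).
  rewrite big_filter; apply: ler_sum => -[[[i|i] [j|j]] t] //=; rewrite ?eqxx //.
  by case: ifP => //; rewrite eqxx.
rewrite -big_filter; apply: ler_sum_sub; rewrite ?ball_uniq ?filter_uniq //; last first.
  by move=> e _; exact: sqr_ge0.
move=> -[[[i|i] [j|j]] t]; rewrite mem_filter mem_ball /= ?eqxx //.
case: ifP; rewrite ?eqxx // => ijm _; rewrite /rad /sup_norm /dual; case: t => /=; lia.
Qed.

(** The urn flow spreads from the origin to the uniform law on the antidiagonal of the square
    [[0, m]^2], and its image under the central reflection gathers that mass at [(m, m)]. The
    antidiagonal masses are symmetric and cancel. *)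
Lemma diag_flow_nat (m J : nat) : (m <= 2 ^ J)%N ->
  sq_flow (0, 0) (m%:Z, m%:Z) (2 * (72 * (J.+1)%:R) + 2 * (72 * (J.+1)%:R)).
Proof.
case: m => [|m] mJ.
  have [g [fg gc]] := sq_flow_refl (0, 0); exists g; split => // s us.
  by apply: le_trans (gc _ us) _; rewrite addr_ge0 // !mulr_ge0.
pose n := m.+1; have n0 : (0 < n)%N by [].
pose w (e : edge) : R := if e.2 then polya_trunc n ((n%:Z - e.1.1 - 1, n%:Z - e.1.2), true)
  else polya_trunc n ((n%:Z - e.1.1, n%:Z - e.1.2 - 1), false).
exists (fun e => polya_trunc n e + w e); split; last first.
  apply: sq_boundedD; first exact: polya_trunc_bounded.
  apply: (@sq_bounded_transport (fun e => if e.2 then ((n%:Z - e.1.1 - 1, n%:Z - e.1.2), true)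
     else ((n%:Z - e.1.1, n%:Z - e.1.2 - 1), false)) (polya_trunc n)); last exact: polya_trunc_bounded.
    by move=> [[e1 e2] []] [[f1 f2] []] //= [] h1 h2; congr (_, _, _); lia.
  by move=> [x []].
move=> z; transitivity (div (polya_trunc n) z - div (polya_trunc n) (n%:Z - z.1, n%:Z - z.2)).
  case: z => z1 z2; rewrite /div /w /=.
  rewrite (_ : n%:Z - (z1 - 1) - 1 = n%:Z - z1); last lia.
  by rewrite (_ : n%:Z - (z2 - 1) - 1 = n%:Z - z2); [ring | lia].
rewrite !div_polya_trunc // antidiag_mass_sym.
have -> : ((n%:Z - z.1, n%:Z - z.2) == (0, 0)) = (z == (n%:Z, n%:Z)).
  by case: z => z1 z2; rewrite -!pair_eqE /pair_eq /=; lia.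
ring.
Qed.

Lemma diag_flow (p : int) (J : nat) : (`|p| <= 2 ^ J)%N ->
  sq_flow (0, 0) (p, p) (2 * (72 * (J.+1)%:R) + 2 * (72 * (J.+1)%:R)).
Proof.
case: p => m mJ; first exact: diag_flow_nat.
have := sq_flow_sym (sq_flow_shift (- (m.+1)%:Z, - (m.+1)%:Z) (@diag_flow_nat m.+1 J mJ)).
by rewrite /vadd /= !addr0 !addNr NegzE.
Qed.

(** Decompose [v = p (1, 1) + q (1, -1) + t (1, 0)] with [t] the parity of the coordinate sum: two
    diagonal flows and at most one edge. Each concatenation doubles the bounds, which explains the
    constant. *)
Lemma sq_flow_exists : exists C : R, 0 < C /\ forall (v : vertex) (J : nat),
  (l1norm v <= 2 ^ J)%N -> sq_flow (0, 0) v (C * (J.+1)%:R).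
Proof.
exists (2 * (2 * (2 * 72 + 2 * 72) + 2 * (2 * 72 + 2 * 72)) + 2); split; first by rewrite addr_gt0.
move=> [x y] J; rewrite /l1norm /= => vJ.
pose p := ((x + y) %/ 2)%Z; pose q := p - y; pose t := x - p - q.
have pE : t = 0 \/ t = 1 by rewrite /t /q /p; lia.
have f1 : sq_flow (0, 0) (p, p) (2 * (72 * (J.+1)%:R) + 2 * (72 * (J.+1)%:R)).
  by apply: diag_flow; rewrite /p; lia.
have f2 : sq_flow (p, p) (p + q, p - q) (2 * (72 * (J.+1)%:R) + 2 * (72 * (J.+1)%:R)).
  have := sq_flow_shift (p, p) (sq_flow_mirror (@diag_flow q J _)).
  by rewrite /vadd /= !addr0; apply; rewrite /q /p; lia.
have f3 : sq_flow (p + q, p - q) (x, y) 1.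
  have -> : y = p - q by rewrite /q; lia.
  have -> : x = p + q + t by rewrite /t; lia.
  case: pE => ->; last by have := sq_flow_step (p + q, p - q); rewrite /vadd /= addr0.
  have [g [fg gc]] := sq_flow_refl (p + q, p - q); exists g; rewrite addr0; split => // s us.
  by apply: le_trans (gc _ us) _.
have [g [fg gc]] := sq_flow_trans (sq_flow_trans f1 f2) f3; exists g; split => // s us.
apply: le_trans (gc _ us) _; have : 1 <= (J.+1)%:R :> R by rewrite ler1n.
move: (J.+1)%:R => j; lra.
Qed.

End Flows.

(** * Decay of almost minimal flows *)

Section Decay.
Variable R : realType.
Implicit Types (g r : edge -> R).

(** Induction on [d]: with [gam = be ^+ 2], one factor [be ^+ j] absorbs one power of [j.+1] by
    Bernoulli's inequality, and the other is left to the induction hypothesis. *)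
Lemma expr_poly_bounded (d : nat) (gam : R) : 0 < gam < 1 ->
  exists M : R, 0 <= M /\ forall j : nat, gam ^+ j * (j.+1)%:R ^+ d <= M.
Proof.
elim: d gam => [|d IH] gam /andP[g0 g1].
  by exists 1; split => // j; rewrite expr0 mulr1 exprn_ile1 // ltW.
pose be := Num.sqrt gam.
have be0 : 0 < be by rewrite sqrtr_gt0.
have beE : be ^+ 2 = gam by rewrite sqr_sqrtr // ltW.
have be1 : be < 1 by rewrite -(@ltr_pXn2r _ 2) ?nnegrE ?ltW // beE expr1n.
have [M [M0 HM]] := IH be (introT andP (conj be0 be1)).
pose h := be^-1 - 1.
have h0 : 0 < h by rewrite subr_gt0 invf_gt1.
have bh : be * h = 1 - be by rewrite /h mulrBr divff ?gt_eqF // mulr1.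
have lin (j : nat) : be ^+ j * (1 + j%:R * h) <= 1.
  elim: j => [|j IHj]; first by rewrite mul0r addr0 mulr1.
  apply: le_trans IHj; rewrite exprSr -mulrA ler_pM2l ?exprn_gt0 //.
  rewrite -natr1 mulrDr mulr1 mulrCA bh.
  have j0 : 0 <= j%:R :> R by rewrite ler0n.
  have : j%:R * (be * h) <= j%:R * h by apply: ler_wpM2l => //; apply: ler_piMl; exact: ltW.
  rewrite bh; lra.
have key (j : nat) : be ^+ j * (j.+1)%:R <= 1 + h^-1.
  apply: (@le_trans _ _ (be ^+ j * ((1 + h^-1) * (1 + j%:R * h)))).
    rewrite ler_pM2l ?exprn_gt0 // -natr1.
    have -> : (1 + h^-1) * (1 + j%:R * h) = 1 + j%:R * h + h^-1 + j%:R by field; rewrite gt_eqF.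
    have : 0 <= j%:R * h by rewrite mulr_ge0 // ltW.
    have : 0 < h^-1 by rewrite invr_gt0.
    lra.
  rewrite mulrCA -[leRHS]mulr1 ler_pM2l // ltr_wpDr // ltW // invr_gt0 //.
exists (M * (1 + h^-1)); split.
  by rewrite mulr_ge0 // addr_ge0 // invr_ge0 ltW.
move=> j; rewrite -beE -exprM mul2n -addnn exprD exprSr.
rewrite mulrACA; apply: ler_pM => //.
  by rewrite mulr_ge0 ?exprn_ge0 ?ler0n // ltW.
by rewrite mulr_ge0 ?exprn_ge0 ?ler0n // ltW.
Qed.

(** [u i] stands for the energy within radius [2 ^ i] of a pole, and the drift [D * (i + 2)] for
    that of the reference flow at the next scale. An affine function [L * (i + m)] is a
    supersolution of the recursion, while the datum at scale [J] decays geometrically. *)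
Lemma contraction_linear (gam D : R) : 0 < gam < 1 -> 0 <= D ->
  exists L : R, 0 < L /\ forall (u : nat -> R) (J : nat) (T : R),
    (forall i, (i < J)%N -> u i <= gam * (u i.+1 + D * (i.+2)%:R + 1)) -> u J <= T ->
    forall i, (i <= J)%N -> u i <= L * (i.+1)%:R + gam ^+ (J - i) * T.
Proof.
move=> /andP[g0 g1] D0.
have d0 : 0 < 1 - gam by rewrite subr_gt0.
pose m := 2 / (1 - gam); pose L := 2 * (2 * D + 1) / (1 - gam).
have mE : (1 - gam) * m = 2 by rewrite mulrC divfK // gt_eqF.
have LE : (1 - gam) * L = 2 * (2 * D + 1) by rewrite mulrC divfK // gt_eqF.
have m1 : 1 <= m by rewrite ler_pdivlMr // mul1r; lra.
have L0 : 0 < L by rewrite divr_gt0 // mulr_gt0 // ltr_wpDl // mulr_ge0.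
exists (L * m); split; first by rewrite mulr_gt0 // (lt_le_trans _ m1).
move=> u J T Hu uJ.
suff main k : (k <= J)%N -> u (J - k)%N <= L * ((J - k)%:R + m) + gam ^+ k * T.
  move=> i iJ; have := main (J - i)%N (leq_subr _ _); rewrite subKn // => /le_trans; apply.
  rewrite lerD2r -mulrA ler_pM2l // -natr1 mulrDr mulr1 lerD2r ler_peMl //.
elim: k => [|k IH] kJ.
  rewrite subn0 expr0 mul1r; apply: le_trans uJ _; rewrite lerDr mulr_ge0 ?ltW //.
  by rewrite ltr_wpDl // (lt_le_trans _ m1).
have := Hu (J - k.+1)%N; rewrite (_ : (J - k.+1).+1 = J - k)%N; last lia.
move=> /(_ ltac:(lia)) H; have {}IH := IH (ltnW kJ).
set i := (J - k.+1)%N in H *; have iE : (J - k = i.+1)%N by rewrite /i; lia.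
rewrite iE -natr1 in IH.
have i2 : (i.+2)%:R = i%:R + 2 :> R by rewrite -addn2 natrD.
rewrite iE i2 in H; have i0 : 0 <= i%:R :> R by rewrite ler0n.
apply: le_trans H _; rewrite exprS.
apply: (@le_trans _ _ (gam * (L * (i%:R + 1 + m) + gam ^+ k * T + D * (i%:R + 2) + 1))).
  by rewrite ler_pM2l // !lerD2r.
move: IH => _; move: (gam ^+ k) => G; move: i%:R i0 => x x0 {i iE i2}.
(* half of the gap (1 - gam) L (x + m) pays for gam L, the other half for the drift *)
have h1 : (1 - gam) * L * (x + m) = (1 - gam) * L * x / 2 + L + (1 - gam) * L * (x + m) / 2.
  have : (1 - gam) * L * m = 2 * L by rewrite mulrAC mE.
  lra.
have h2 : (D * (x + 2) + 1) <= (1 - gam) * L * (x + m) / 2.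
  rewrite LE; have : 0 <= (2 * D + 1) * (m - 1) by rewrite mulr_ge0 ?subr_ge0 ?addr_ge0 ?mulr_ge0.
  have : 0 <= D * x by rewrite mulr_ge0.
  lra.
have h3 : 0 <= (1 - gam) * L * x by apply: mulr_ge0 => //; apply: mulr_ge0; exact: ltW.
have h4 : gam * L <= L by apply: ler_piMl; exact: ltW.
have h5 : gam * (D * (x + 2) + 1) <= D * (x + 2) + 1.
  by apply: ler_piMl; [rewrite addr_ge0 // mulr_ge0 // addr_ge0 | exact: ltW].
have -> : gam * (L * (x + 1 + m) + G * T + D * (x + 2) + 1) =
  gam * (L * (x + m)) + gam * L + gam * G * T + gam * (D * (x + 2) + 1) by ring.
have : L * (x + m) = gam * (L * (x + m)) + (1 - gam) * L * (x + m) by ring.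
lra.
Qed.

Lemma contraction_geometric (gam eps T : R) (u : nat -> R) (J : nat) : 0 < gam < 1 -> 0 <= eps ->
  (forall i, (i < J)%N -> u i <= gam * (u i.+1 + eps)) -> u J <= T ->
  u 0%N <= gam ^+ J * T + J%:R * eps.
Proof.
move=> /andP[g0 g1] e0 Hu uJ.
suff main k : (k <= J)%N -> u (J - k)%N <= gam ^+ k * T + k%:R * eps.
  by have := main J (leqnn _); rewrite subnn.
elim: k => [|k IH] kJ; first by rewrite subn0 expr0 mul1r mul0r addr0.
have := Hu (J - k.+1)%N; rewrite (_ : (J - k.+1).+1 = J - k)%N; last lia.
move=> /(_ ltac:(lia)) H; apply: le_trans H _.
have {}IH := IH (ltnW kJ).
apply: (@le_trans _ _ (gam * (gam ^+ k * T + k%:R * eps + eps))).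
  by rewrite ler_pM2l // lerD2r.
rewrite mulrDr exprS -natr1 (mulrDr gam) -mulrA -addrA lerD2l mulrDl mul1r -mulrDr.
by apply: ler_piMl; [rewrite addr_ge0 // mulr_ge0 | exact: ltW].
Qed.

(* [Q] plays the role of the effective resistance. *)
Definition near_min r (v : vertex) g (Q eps : R) : Prop :=
  [/\ is_flow (0, 0) v g,
      forall s, uniq s -> \sum_(e <- s) r e * g e ^+ 2 <= Q + eps &
      forall g' c, is_flow (0, 0) v g' ->
        (forall s, uniq s -> \sum_(e <- s) r e * g' e ^+ 2 <= c) -> Q <= c].

(** A finite set of edges outside [s], joined to [s], has [g]-energy at most [Q + eps]. So every
    finite energy of [g'] is at most [Q + eps], minus the energy of [g] on [s], plus that of [g'] on
    [s]; minimality of [Q] is applied to this bound. *)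
Lemma near_min_local r v g Q eps (s : seq edge) g' :
  (forall e, 0 <= r e) -> near_min r v g Q eps -> uniq s -> is_flow (0, 0) v g' ->
  (forall e, e \notin s -> g' e = g e) ->
  \sum_(e <- s) r e * g e ^+ 2 <= \sum_(e <- s) r e * g' e ^+ 2 + eps.
Proof.
move=> r0 [fg gQ Qmin] us fg' g'E.
have F0 f e : 0 <= r e * f e ^+ 2 :> R by rewrite mulr_ge0 // sqr_ge0.
suff : Q <= Q + eps - \sum_(e <- s) r e * g e ^+ 2 + \sum_(e <- s) r e * g' e ^+ 2 by lra.
apply: (Qmin g') => // t ut.
rewrite (bigID (mem s)) /= addrC; apply: lerD; last first.
  rewrite -big_filter; apply: ler_sum_sub; rewrite ?filter_uniq //.
  by move=> e; rewrite mem_filter => /andP[].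
rewrite lerBrDr (eq_bigr (fun e => r e * g e ^+ 2)); last by move=> e /g'E ->.
have := gQ (s ++ [seq e <- t | e \notin s]).
rewrite big_cat /= big_filter addrC; apply.
rewrite cat_uniq us filter_uniq // andbT /=; apply/hasPn => e.
by rewrite mem_filter => /andP[].
Qed.

Definition shift_edge (p : vertex) (e : edge) : edge := (vadd p e.1, e.2).

Lemma shift_edge_inj p : injective (shift_edge p).
Proof. by move=> [[e1 e2] t] [[f1 f2] t'] /= [] /addrI -> /addrI -> ->. Qed.

Lemma div_shift p g x : div (g \o shift_edge p) x = div g (vadd p x).
Proof. by case: x p => x1 x2 [p1 p2]; rewrite /div /shift_edge /vadd /= !addrA. Qed.

Lemma curl_shift p (chi : vertex -> R) e :
  curl (fun x => chi (x.1 - p.1, x.2 - p.2)) (shift_edge p e) = curl chi e.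
Proof.
case: e p => -[x y] t [p q]; rewrite /curl /shift_edge /dual /vadd /=.
have E1 (u w : int) : u + w - u = w by rewrite addrAC subrr add0r.
have E2 (u w : int) : u + w - 1 - u = w - 1 by lia.
by case: t; rewrite /= !E1 !E2.
Qed.

Lemma near_min_hole_filling (a b : R) : 0 < a -> a <= b ->
  exists gam : R, 0 < gam < 1 /\
  forall r v g Q eps (p : vertex) g0 (K : nat), (0 < K)%N -> 0 <= eps ->
  (forall e, a <= r e <= b) -> near_min r v g Q eps ->
  (forall x, (sup_norm x <= 2 * K)%N -> div g (vadd p x) = div g0 x) ->
  sq_energy K (g \o shift_edge p) <=
    gam * (sq_energy (2 * K) (g \o shift_edge p) + sq_energy (2 * K) g0 + eps).
Proof.
move=> a0 ab; have [gam [gam01 HF]] := hole_filling a0 ab.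
exists gam; split => // r v g Q eps p g0 K K0 e0 rab nm dg.
apply: (HF (r \o shift_edge p)) => //; [by move=> e; exact: rab | by move=> x xK; rewrite div_shift dg | ].
move=> chi chi0.
pose chi' (x : vertex) := chi (x.1 - p.1, x.2 - p.2).
have r0 e : 0 <= r e by apply: le_trans (ltW a0) _; case/andP: (rab e).
have := @near_min_local r v g Q eps [seq shift_edge p e | e <- ball (2 * K)]
  (fun e => g e + curl chi' e) r0 nm.
rewrite map_inj_uniq; last exact: shift_edge_inj.
rewrite ball_uniq !big_map => /(_ isT) H.
under [X in _ <= X + _]eq_bigr do rewrite -(curl_shift p).
apply: H.
  move=> z; case: nm => fg _ _; rewrite -fg.
  transitivity (div g z + div (curl chi') z); first by rewrite /div; ring.
  by rewrite div_curl addr0.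
move=> e; have [f ->] : exists f, e = shift_edge p f.
  exists ((e.1.1 - p.1, e.1.2 - p.2), e.2); case: e => -[e1 e2] t.
  by rewrite /shift_edge /vadd /= !(addrC p.1) !(addrC p.2) !subrK.
rewrite mem_map; last exact: shift_edge_inj.
(* Such an edge has radius at least [2 * K + 1], so even its inner face has norm at least [2 * K],
   where [chi] vanishes. *)
rewrite mem_ball -ltnNge => fK; rewrite curl_shift.
have [u [w [uw wk _ uk]]] := rad_pair f.
have cu : chi u = 0 by apply: chi0; rewrite -ltnS (leq_trans fK).
have cw : chi w = 0 by apply: chi0; rewrite wk ltnW.
have : curl chi f ^+ 2 = 0.
  by rewrite curl_sqr; case: uw => -[<- <-]; rewrite cu cw subrr expr0n.
by move=> /eqP; rewrite expf_eq0 /= => /eqP ->; rewrite addr0.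
Qed.

End Decay.

(** * Fourth powers of the current *)

Section Quartic.
Variable R : realType.
Implicit Types (g r : edge -> R).

(** Comparison with the explicit flow bounds [Q] by [b * (C * (J + 1))]; the summand [1] absorbs
    [eps], and dividing by [a] passes from weighted to plain squares. *)
Lemma near_min_total (a b : R) : 0 < a -> a <= b ->
  exists C : R, 0 < C /\ forall r v g Q eps (J : nat), (l1norm v <= 2 ^ J)%N ->
  (forall e, a <= r e <= b) -> eps <= 1 -> near_min r v g Q eps ->
  sq_bounded g (C * (J.+1)%:R).
Proof.
move=> a0 ab; have b0 : 0 < b by exact: lt_le_trans ab.
have [C [C0 HC]] := sq_flow_exists R.
exists ((b * C + 1) / a); split; first by rewrite divr_gt0 // addr_gt0 // mulr_gt0.
move=> r v g Q eps J vJ rab e1 [fg gQ Qmin] s us.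
have [g' [fg' gc']] := HC v J vJ.
have j1 : 1 <= (J.+1)%:R :> R by rewrite ler1n.
have QC : Q <= b * (C * (J.+1)%:R).
  apply: (Qmin g') => // t ut; apply: (@le_trans _ _ (b * \sum_(e <- t) g' e ^+ 2)).
    rewrite big_distrr /=; apply: ler_sum => e _; apply: ler_wpM2r; first exact: sqr_ge0.
    by case/andP: (rab e).
  by rewrite ler_pM2l // gc'.
rewrite mulrAC ler_pdivlMr // mulrC.
apply: (@le_trans _ _ (\sum_(e <- s) r e * g e ^+ 2)).
  rewrite big_distrr /=; apply: ler_sum => e _; apply: ler_wpM2r; first exact: sqr_ge0.
  by case/andP: (rab e).
by apply: le_trans (gQ _ us) _; move: j1 QC; move: (J.+1)%:R => j; lra.
Qed.

Definition vopp (p : vertex) : vertex := (- p.1, - p.2).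

Lemma shift_edgeK p e : shift_edge p (shift_edge (vopp p) e) = e.
Proof. by case: e p => -[x y] t [p q]; rewrite /shift_edge /vadd /= !addNKr. Qed.

Lemma sq_energy_shift p K g (t : seq edge) : uniq t ->
  {in t, forall e, (rad (shift_edge (vopp p) e) <= K)%N} ->
  \sum_(e <- t) g e ^+ 2 <= sq_energy K (g \o shift_edge p).
Proof.
move=> ut tK.
rewrite (_ : \sum_(e <- t) _ =
  \sum_(e <- [seq shift_edge (vopp p) e | e <- t]) (g \o shift_edge p) e ^+ 2); last first.
  by rewrite big_map; apply: eq_bigr => e _; rewrite /= shift_edgeK.
apply: ler_sum_sub; rewrite ?ball_uniq //.
- by rewrite map_inj_uniq //; exact: shift_edge_inj.
- by move=> _ /mapP[e et ->]; rewrite mem_ball tK.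
- by move=> e _; exact: sqr_ge0.
Qed.

Lemma sum_quartic (t : seq edge) g (X Y : R) : 0 <= X ->
  {in t, forall e, g e ^+ 2 <= X} -> \sum_(e <- t) g e ^+ 2 <= Y ->
  \sum_(e <- t) g e ^+ 4 <= X * Y.
Proof.
move=> X0 gX gY; apply: (@le_trans _ _ (X * \sum_(e <- t) g e ^+ 2)); last by rewrite ler_wpM2l.
rewrite big_distrr /= big_seq [leRHS]big_seq; apply: ler_sum => e et.
by rewrite (_ : 4 = 2 + 2)%N // exprD; apply: ler_wpM2r; [exact: sqr_ge0 | exact: gX].
Qed.

(** The energy bound [A] serves twice, for the largest square and for the sum of the squares. *)
Lemma near_quartic p K g (t : seq edge) A : uniq t ->
  {in t, forall e, (rad (shift_edge (vopp p) e) <= K)%N} ->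
  sq_energy K (g \o shift_edge p) <= A ->
  \sum_(e <- t) g e ^+ 4 <= A ^+ 2.
Proof.
move=> ut tK gA.
have A0 : 0 <= A by apply: le_trans gA; exact: sq_energy_ge0.
rewrite expr2; apply: sum_quartic => //; last first.
  by apply: le_trans gA; exact: sq_energy_shift.
move=> e et; apply: le_trans gA.
have := @sq_energy_shift p K g [:: e] isT; rewrite big_seq1; apply.
by move=> f; rewrite inE => /eqP ->; exact: tK.
Qed.

Lemma sup_norm_vopp x : sup_norm (vopp x) = sup_norm x.
Proof. by rewrite /sup_norm /vopp /= !abszN. Qed.

(** Hole filling over dyadic scales in two regimes. Around one pole, in boxes that miss the other,
    the reference flow is [polya], with opposite sign at the sink [v], and the energy grows at most
    linearly in [i] up to a decaying term. Around a point whose box misses both poles the reference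
    flow is [0], and the energy contracts geometrically down to radius [1]. *)
Lemma near_min_decay (a b : R) : 0 < a -> a <= b ->
  exists gam L : R, [/\ 0 < gam < 1, 0 < L &
  forall r v g Q eps (T : R),
  (forall e, a <= r e <= b) -> 0 <= eps -> near_min r v g Q eps -> sq_bounded g T ->
  (forall (J i : nat) p, eps <= 1 -> p = (0, 0) \/ p = v -> (2 ^ J < sup_norm v)%N -> (i <= J)%N ->
     sq_energy (2 ^ i) (g \o shift_edge p) <= L * (i.+1)%:R + gam ^+ (J - i) * T) /\
  (forall (j : nat) p, (2 ^ j < sup_norm p)%N -> (2 ^ j < sup_norm (vadd (vopp p) v))%N ->
     sq_energy 1 (g \o shift_edge p) <= gam ^+ j * T + j%:R * eps)].
Proof.
move=> a0 ab; have [gam [g01 HF]] := near_min_hole_filling a0 ab.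
(* [72] is the cost of one dyadic annulus in [polya_energy]. *)
have [L [L0 HL]] := @contraction_linear _ gam 72 g01 (ler0n _ _).
exists gam, L; split => // r v g Q eps T rab e0 nm gT.
have gK p K : sq_energy K (g \o shift_edge p) <= T.
  rewrite /sq_energy; apply: le_trans (gT [seq shift_edge p e | e <- ball K] _).
    by rewrite big_map.
  by rewrite map_inj_uniq ?ball_uniq //; exact: shift_edge_inj.
have [fg _ _] := nm.
split.
  move=> J i p e1 pv Jv iJ.
  apply: (HL (fun k => sq_energy (2 ^ k) (g \o shift_edge p)) J T _ _ i iJ) => // {i iJ} k kJ.
  have [g0 [dg0 eg0]] : exists g0, (forall x, (sup_norm x <= 2 ^ J)%N -> div g (vadd p x) = div g0 x)
      /\ forall j, sq_energy (2 ^ j) g0 <= 72 * (j.+1)%:R.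
    case: pv => ->.
      exists (@polya R); split; last exact: polya_energy.
      move=> [x1 x2] xJ; rewrite div_polya fg /vadd /= !add0r.
      have -> : ((x1, x2) == v) = false.
        by apply/negP => /eqP xv; move: Jv; rewrite -xv ltnNge xJ.
      by rewrite subr0.
    exists (fun e => - polya R e); split; last first.
      by move=> j; apply: le_trans (polya_energy R j); rewrite /sq_energy; under eq_bigr do rewrite sqrrN.
    move=> [x1 x2] xJ; rewrite fg; transitivity (- div (@polya R) (x1, x2)); last by rewrite /div; ring.
    rewrite div_polya; case: v Jv {fg nm} => v1 v2 Jv.
    rewrite /vadd /= -!pair_eqE /pair_eq /=.
    have -> : (v1 + x1 == 0) && (v2 + x2 == 0) = false.
      by move: Jv xJ; rewrite /sup_norm /=; lia.
    by rewrite sub0r; congr (- (nat_of_bool _)%:R); lia.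
  have k2 : (2 * 2 ^ k <= 2 ^ J)%N by rewrite -expnS leq_exp2l.
  have := HF r v g Q eps p g0 (2 ^ k)%N; rewrite expn_gt0 => /(_ isT e0 rab nm).
  rewrite -expnS => H; apply: le_trans (H _) _.
    by move=> x xk; apply: dg0; apply: leq_trans xk _; rewrite expnS.
  case/andP: g01 => g0' _; rewrite ler_pM2l //; apply: lerD => //; rewrite lerD2l; exact: eg0.
move=> j p pj pvj.
apply: (@contraction_geometric _ gam eps T (fun k => sq_energy (2 ^ k) (g \o shift_edge p)) j) => //.
move=> k kj.
have k2 : (2 * 2 ^ k <= 2 ^ j)%N by rewrite -expnS leq_exp2l.
have := HF r v g Q eps p (fun=> 0) (2 ^ k)%N; rewrite expn_gt0 => /(_ isT e0 rab nm).
rewrite -expnS => H; apply: le_trans (H _) _; last first.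
  case/andP: g01 => g0' _; rewrite ler_pM2l // lerD2r.
  by rewrite /sq_energy [X in _ + X]big1 ?addr0 // => e _; rewrite expr0n.
move=> [x1 x2] xk; rewrite fg.
have {}xk : (sup_norm (x1, x2) <= 2 ^ j)%N by apply: leq_trans xk _; rewrite expnS.
rewrite (_ : div (fun=> 0) _ = 0); last by rewrite /div; ring.
have -> : (vadd p (x1, x2) == (0, 0)) = false.
  apply/negP => /eqP; rewrite /vadd; case: p pj {pvj H} => p1 p2 pj [] /= h1 h2.
  by move: pj xk; rewrite /sup_norm /=; lia.
have -> : (vadd p (x1, x2) == v) = false.
  apply/negP => /eqP pxv; move: pvj; rewrite -pxv ltnNge => /negP; apply.
  by case: p {pj pxv H} => p1 p2; rewrite /vadd /vopp /= !addKr.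
by rewrite subrr.
Qed.

Lemma cube_root (J : nat) : exists j : nat, (j ^ 3 <= J < j.+1 ^ 3)%N.
Proof.
elim: J => [|J [j /andP[j1 j2]]]; first by exists 0%N.
case: (leqP (j.+1 ^ 3) J.+1) => h; last by exists j; rewrite h (leq_trans j1).
by exists j.+1; rewrite h /=; have := @ltn_exp2r j.+1 j.+2 3 isT; rewrite ltnS leqnn => h3; lia.
Qed.

Lemma far_radius (e : edge) (K : nat) : (K < rad e)%N -> (K <= sup_norm e.1)%N.
Proof.
have [u [w [uw wk uk1 uk2]]] := rad_pair e => Ke.
by case: uw => -[<- _]; [rewrite -ltnS (leq_trans Ke) | rewrite wk ltnW].
Qed.

Lemma split_sum3 (s : seq edge) (P1 P2 : pred edge) (F : edge -> R) :
  \sum_(e <- s) F e = \sum_(e <- [seq e <- s | P1 e]) F e +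
   (\sum_(e <- [seq e <- s | ~~ P1 e && P2 e]) F e +
    \sum_(e <- [seq e <- s | ~~ P1 e && ~~ P2 e]) F e).
Proof. by rewrite !big_filter (bigID P1) /= [X in _ + X](bigID P2). Qed.

Lemma near_min_quartic_split (a b : R) : 0 < a -> a <= b ->
  exists gam L C : R, [/\ 0 < gam < 1, 0 < L, 0 < C &
  forall r v g Q eps (J j : nat) (T := C * (J + 3)%:R),
  (forall e, a <= r e <= b) -> 0 <= eps -> eps <= 1 -> near_min r v g Q eps ->
  (2 ^ J < sup_norm v <= 2 ^ J.+1)%N -> (j < J)%N ->
  forall s, uniq s ->
   \sum_(e <- s) g e ^+ 4 <= 2 * (L * (j.+2)%:R + gam ^+ (J - j.+1) * T) ^+ 2 +
      (gam ^+ j * T + j%:R * eps) * T].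
Proof.
move=> a0 ab; have [C [C0 HC]] := near_min_total a0 ab.
have [gam [L [g01 L0 HD]]] := near_min_decay a0 ab.
exists gam, L, C; split => // r v g Q eps J j T rab e0 e1 nm /andP[Jv vJ] jJ s us.
(* The l1 norm is at most twice the sup norm; this extra power of two is the origin of [J + 3] in
   [T]. *)
have vJ2 : (l1norm v <= 2 ^ J.+2)%N.
  move: vJ; rewrite /l1norm /sup_norm expnS [in X in _ -> X]expnS => vJ.
  by move: vJ; rewrite expnS; lia.
have gT : sq_bounded g T.
  by have := HC r v g Q eps J.+2 vJ2 rab e1 nm; rewrite /T addn3.
have [Hnear Hfar] := HD r v g Q eps T rab e0 nm gT.
set A := L * _ + _.
(* The radius is [2 ^ j.+1] because [far_radius] only gives a weak inequality for the base vertex of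
   a far edge, while the decay estimate wants a distance strictly above [2 ^ j]. *)
pose near p e := (rad (shift_edge (vopp p) e) <= 2 ^ j.+1)%N.
rewrite (split_sum3 s (near (0, 0)) (near v)).
have nearA p : p = (0, 0) \/ p = v -> sq_energy (2 ^ j.+1) (g \o shift_edge p) <= A.
  by move=> pv; exact: Hnear.
have -> : 2 * A ^+ 2 + (gam ^+ j * T + j%:R * eps) * T =
  A ^+ 2 + (A ^+ 2 + (gam ^+ j * T + j%:R * eps) * T) by ring.
apply: lerD.
  apply: (@near_quartic (0, 0) (2 ^ j.+1)); rewrite ?filter_uniq //; last by apply: nearA; left.
  by move=> e; rewrite mem_filter => /andP[].
apply: lerD.
  apply: (@near_quartic v (2 ^ j.+1)); rewrite ?filter_uniq //; last by apply: nearA; right.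
  by move=> e; rewrite mem_filter => /andP[/andP[]].
have T0 := sq_bounded_ge0 gT.
case/andP: (g01) => g0' _.
apply: sum_quartic.
- by rewrite addr_ge0 // mulr_ge0 // exprn_ge0 // ltW.
- move=> e; rewrite mem_filter => /andP[/andP[]]; rewrite /near -!ltnNge => e1' e2' _.
  have h1 := far_radius e1'; have h2 := far_radius e2'.
  have jj : (2 ^ j < 2 ^ j.+1)%N by rewrite ltn_exp2l.
  have := Hfar j e.1.
  have -> : vadd (vopp e.1) v = vopp (shift_edge (vopp v) e).1.
    by case: e v {e1' e2' h1 h2 nm vJ2 Jv vJ HD HC Hnear Hfar nearA gT} => -[x y] t [v1 v2]; rewrite /vadd /vopp /=; congr (_, _); ring.
  rewrite sup_norm_vopp => /(_ _ (leq_trans jj h2)) H.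
  apply: le_trans (H _); last first.
    by apply: leq_trans jj _; move: h1; case: e {e1' e2' h2 H} => -[x y] t; rewrite /shift_edge /vadd /vopp /= !oppr0 !add0r.
  (* Recentred at its own base vertex the edge has radius [1], so its square is part of the energy
     of the unit ball. *)
  have := @sq_energy_shift e.1 1 g [:: e] isT; rewrite big_seq1; apply.
  move=> f; rewrite inE => /eqP ->; case: e {e1' e2' h1 h2 H} => -[x y] t.
  by rewrite /shift_edge /vadd /vopp /= !addNr; case: t.
- by apply: gT; rewrite filter_uniq.
Qed.

End Quartic.

(** * Choice of the splitting scale *)

Section QuarticBound.
Variable R : realType.
Implicit Types (g r : edge -> R).

Lemma sup_norm_le_l1norm v : (sup_norm v <= l1norm v)%N.
Proof. by rewrite /sup_norm /l1norm; lia. Qed.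

(** Read [j ^ 2] as [(j ^ 3)^(2/3)] and bound [J] by the logarithm of [n] in base [2]. *)
Lemma cube_root_log (j J n : nat) : (j ^ 3 <= J)%N -> (2 ^ J <= n)%N ->
  j%:R ^+ 2 <= (ln 2)^-1 `^ (2 / 3) * ln n%:R `^ (2 / 3) :> R.
Proof.
move=> jJ Jn.
have l2 : 0 < ln 2 :> R by rewrite ln_gt0 // ltr1n.
have Jln : J%:R <= (ln 2)^-1 * ln n%:R :> R.
  rewrite mulrC ler_pdivlMr // mulr_natl -lnXn ?ltr0n //.
  rewrite ler_ln ?posrE ?exprn_gt0 ?ltr0n //; last by rewrite (leq_trans _ Jn) // expn_gt0.
  by rewrite -natrX ler_nat.
have lnn : 0 <= ln n%:R :> R.
  by apply: ln_ge0; rewrite ler1n (leq_trans _ Jn) // expn_gt0.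
rewrite -powRM // ?invr_ge0 ?(ltW l2) //.
have -> : j%:R ^+ 2 = (j ^ 3)%:R `^ (2 / 3) :> R.
  rewrite natrX -(powR_mulrn 3) ?ler0n // -powRrM (_ : 3%:R * (2 / 3) = 2%:R :> R); last by field.
  by rewrite powR_mulrn.
apply: ge0_ler_powR; rewrite ?nnegrE //.
  by rewrite mulr_ge0 // invr_ge0 ltW.
by apply: le_trans Jln; rewrite ler_nat.
Qed.

Lemma near_min_quartic (a b : R) : 0 < a -> a <= b ->
  exists C : R, 0 < C /\ exists N : nat, forall v : vertex, (N <= l1norm v)%N ->
  exists eps0 : R, 0 < eps0 /\ forall r g Q eps,
  (forall e, a <= r e <= b) -> 0 <= eps -> eps <= eps0 -> near_min r v g Q eps ->
  forall s, uniq s -> \sum_(e <- s) g e ^+ 4 <= C * ln (l1norm v)%:R `^ (2 / 3).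
Proof.
move=> a0 ab; have [gam [L [C [g01 L0 C0 HS]]]] := near_min_quartic_split a0 ab.
(* The far term carries [T] twice, and [T] is at most a multiple of [(j + 1)^3]: hence the exponent
   [6]. *)
have [M [M0 HM]] := expr_poly_bounded 6 g01.
case/andP: (g01) => g0 g1.
pose A := 2 * L + 3 * C * M.
pose C1 := 2 * A ^+ 2 + 9 * C ^+ 2 * M + 1.
have C10 : 0 < C1.
  by rewrite ltr_wpDl // addr_ge0 // mulr_ge0 // ?sqr_ge0 // mulr_ge0 // sqr_ge0.
pose D := (ln 2)^-1 `^ (2 / 3) : R.
exists (C1 * (4 * D)); split.
  rewrite !mulr_gt0 // powR_gt0 // invr_gt0 ln_gt0 // ltr1n //.
(* This threshold forces [J >= 8], hence [j >= 2]. Then [2 * j + 1 <= j ^ 3 <= J], so that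
   [gam ^+ (J - j.+1) <= gam ^+ j], and also [j + 1 <= 2 * j]. *)
exists (2 ^ 10)%N => v vN.
have v9 : (2 ^ 9 <= sup_norm v)%N.
  by move: vN; rewrite expnS /l1norm /sup_norm; lia.
have v0 : (2 ^ 8 <= (sup_norm v).-1)%N.
  have : (2 ^ 8 < 2 ^ 9)%N by rewrite ltn_exp2l.
  by move: v9; lia.
(* The logarithm is taken of the predecessor so that [2 ^ J < sup_norm v] is strict: a box of radius
   [2 ^ J] around one pole then misses the other. *)
have [J [/andP[J1 J2] J8]] : exists J, (2 ^ J <= (sup_norm v).-1 < 2 ^ J.+1)%N /\ (8 <= J)%N.
  exists (trunc_log 2 (sup_norm v).-1); split; last exact: trunc_log_max.
  by apply: trunc_log_bounds => //; apply: leq_trans v0; rewrite expn_gt0.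
have Jv : (2 ^ J < sup_norm v <= 2 ^ J.+1)%N.
  have p0 : (0 < 2 ^ J)%N by rewrite expn_gt0.
  by apply/andP; split; lia.
(* the energy near a pole contributes [j ^ 2], and far away the factor
   [gam ^ j] beats any power of [J] *)
have {v9 v0 vN J1 J2} [j /andP[j1 j2]] := cube_root J.
have jge2 : (2 <= j)%N.
  rewrite leqNgt; apply/negP => jlt.
  have : (j.+1 ^ 3 <= 2 ^ 3)%N by rewrite leq_exp2r.
  by clear -j2 J8; lia.
have jJ : (j.*2.+1 <= J)%N.
  by apply: leq_trans j1; rewrite !expnS expn0 muln1 -addnn; nia.
pose T := C * (J + 3)%:R.
have T0 : 0 <= T by rewrite mulr_ge0 // ltW.
(* Small enough that the accumulated error [j * eps], multiplied by [T] in the far term, stays below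
   [1]. *)
pose eps0 := (j%:R * T + 1)^-1.
have d0 : 0 < j%:R * T + 1 by rewrite ltr_wpDl // mulr_ge0.
have eps01 : eps0 <= 1 by rewrite invf_le1 // lerDr mulr_ge0.
exists eps0; split; first by rewrite invr_gt0.
move=> r g Q eps rab e0 ee nm s us.
have jltJ : (j < J)%N by clear -jJ; lia.
apply: le_trans (HS r v g Q eps J j rab e0 (le_trans ee eps01) nm Jv jltJ s us) _.
rewrite -/T.
pose w := (j.+1)%:R : R.
have w1 : 1 <= w by rewrite ler1n.
have GM : gam ^+ j * w ^+ 6 <= M by exact: HM.
have TC : T <= 3 * C * w ^+ 3.
  rewrite (_ : 3 * C * w ^+ 3 = C * (3 * j.+1 ^ 3)%:R); last by rewrite natrM natrX /w; ring.
  rewrite ler_pM2l; last exact: C0.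
  rewrite ler_nat.
  clear -j2 J8.
  lia.
set G := gam ^+ j in GM *.
have G0 : 0 < G by exact: exprn_gt0.
have w36 : w ^+ 3 <= w ^+ 6 by apply: ler_weXn2l.
have GT : G * T <= 3 * C * M.
  apply: (@le_trans _ _ (G * (3 * C * w ^+ 6))).
    rewrite ler_pM2l //; apply: le_trans TC _; rewrite ler_wpM2l // mulr_ge0 // ltW //.
  by rewrite mulrCA ler_wpM2l // mulr_ge0 // ltW.
have GT2 : G * T * T <= 9 * C ^+ 2 * M.
  apply: (@le_trans _ _ (G * (3 * C * w ^+ 3) ^+ 2)).
    by rewrite -mulrA ler_pM2l // -expr2 lerXn2r ?nnegrE // (le_trans T0).
  rewrite (_ : G * _ = 9 * C ^+ 2 * (G * w ^+ 6)); last by ring.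
  by rewrite ler_wpM2l // mulr_ge0 // sqr_ge0.
have GJ : gam ^+ (J - j.+1) <= G.
  by rewrite /G ler_wiXn2l ?ltW //; clear -jJ; lia.
have eT : j%:R * eps * T <= 1.
  rewrite mulrAC; apply: (@le_trans _ _ (j%:R * T * eps0)).
    by rewrite ler_wpM2l // mulr_ge0.
  by rewrite ler_pdivrMr // mul1r lerDl.
have A1 : L * (j.+2)%:R + gam ^+ (J - j.+1) * T <= A * w.
  have -> : (j.+2)%:R = w + 1 :> R by rewrite /w -[in LHS]natr1.
  have : gam ^+ (J - j.+1) * T <= G * T by rewrite ler_wpM2r.
  have : L * (w + 1) <= L * (2 * w) by rewrite ler_pM2l //; lra.
  have : 3 * C * M * 1 <= 3 * C * M * w by rewrite ler_wpM2l // !mulr_ge0 // ltW.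
  rewrite /A; lra.
have A0 : 0 <= L * (j.+2)%:R + gam ^+ (J - j.+1) * T.
  by rewrite addr_ge0 // mulr_ge0 ?exprn_ge0 // ltW.
have A2 : (L * (j.+2)%:R + gam ^+ (J - j.+1) * T) ^+ 2 <= A ^+ 2 * w ^+ 2.
  by rewrite -exprMn lerXn2r ?nnegrE // (le_trans A0).
apply: (@le_trans _ _ (C1 * w ^+ 2)).
  have w2 : 1 <= w ^+ 2 by rewrite exprn_ege1.
  have : (9 * C ^+ 2 * M + 1) * 1 <= (9 * C ^+ 2 * M + 1) * w ^+ 2.
    apply: ler_wpM2l => //; apply: addr_ge0 => //; apply: mulr_ge0 => //.
    by apply: mulr_ge0 => //; exact: sqr_ge0.
  rewrite /C1 (mulrDl (G * T)); lra.
rewrite -!mulrA ler_pM2l //.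
apply: (@le_trans _ _ (4 * j%:R ^+ 2)).
  rewrite (_ : 4 = 2 ^+ 2 :> R); last by ring.
  rewrite -exprMn lerXn2r ?nnegrE ?mulr_ge0 // -natrM ler_nat; clear -jge2; lia.
rewrite ler_pM2l // /D; apply: (cube_root_log j1).
apply: (@leq_trans (sup_norm v)); first by case/andP: Jv => /ltnW.
exact: sup_norm_le_l1norm.
Qed.

End QuarticBound.

(** * Effective resistance and the Efron-Stein inequality *)

Section EffectiveResistance.
Variable R : realType.
Implicit Types (g r : edge -> R) (v : vertex).

Definition flow_of_edges g (x y : vertex) : R :=
  if y == vadd x (1, 0) then g (x, true)
  else if x == vadd y (1, 0) then - g (y, true)
  else if y == vadd x (0, 1) then g (x, false)
  else if x == vadd y (0, 1) then - g (y, false)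
  else 0.

Definition edges_of_flow (theta : vertex -> vertex -> R) (e : edge) : R :=
  theta (etail e) (ehead e).

Lemma vertex_eqE (x1 x2 y1 y2 : int) :
  ((x1, x2) == (y1, y2) :> vertex) = (x1 == y1) && (x2 == y2).
Proof. by rewrite -pair_eqE. Qed.

Lemma flow_of_edgesK g : edges_of_flow (flow_of_edges g) =1 g.
Proof.
move=> [[x y] []]; rewrite /edges_of_flow /flow_of_edges /etail /ehead /vadd /= !vertex_eqE.
  by rewrite !eqxx.
rewrite (_ : (x + 0 == x + 1) && _ = false); last lia.
rewrite (_ : (x == x + 0 + 1) && _ = false); last lia.
by rewrite !eqxx.
Qed.

Lemma outflow_flow_of_edges g x : outflow (flow_of_edges g) x = div g x.
Proof.
case: x => x y; rewrite /outflow /nbrs !big_cons big_nil /flow_of_edges /vadd /= !vertex_eqE.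
rewrite !eqxx /= (_ : (x + -1 == x + 1) && _ = false); last lia.
rewrite (_ : (x == x + -1 + 1) && (y == y + 0 + 0) = true); last lia.
rewrite (_ : (x + 0 == x + 1) && _ = false); last lia.
rewrite (_ : (x == x + 0 + 1) && _ = false); last lia.
rewrite (_ : (x + 0 == x + 1) && _ = false); last lia.
rewrite (_ : (x == x + 0 + 1) && _ = false); last lia.
rewrite (_ : (y + -1 == y + 1) = false); last lia.
rewrite (_ : (x == x + 0 + 0) && (y == y + -1 + 1) = true); last lia.
by rewrite /div /= !addr0; ring.
Qed.

Lemma outflow_edges_of_flow theta x :
  (forall x y, adj x y -> theta x y = - theta y x) ->
  div (edges_of_flow theta) x = outflow theta x.
Proof.
move=> anti; case: x => x y.
rewrite /outflow /nbrs !big_cons big_nil /div /edges_of_flow /etail /ehead /vadd /= !addr0.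
rewrite !subrK (anti (x, y) (x - 1, y)); last by rewrite /adj /=; lia.
by rewrite (anti (x, y) (x, y - 1)); [ring | rewrite /adj /=; lia].
Qed.

Lemma unit_flow_of_edges (v : vertex) g : v != (0, 0) -> is_flow (0, 0) v g ->
  unit_flow (0, 0) v (flow_of_edges g).
Proof.
move=> v0 fg; split; [|split; [|split]].
- move=> [x1 x2] [y1 y2]; rewrite /adj /flow_of_edges /vadd /= !vertex_eqE => xy.
  have : [\/ y1 = x1 + 1 /\ y2 = x2, y1 = x1 - 1 /\ y2 = x2, y1 = x1 /\ y2 = x2 + 1 |
             y1 = x1 /\ y2 = x2 - 1].
    have : (y1 == x1 + 1) && (y2 == x2) || (y1 == x1 - 1) && (y2 == x2) ||
       (y1 == x1) && (y2 == x2 + 1) || (y1 == x1) && (y2 == x2 - 1) by lia.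
    case/orP => [/orP[/orP[]|]|] /andP[/eqP -> /eqP ->];
      [exact: Or41|exact: Or42|exact: Or43|exact: Or44].
  case=> -[-> ->]; rewrite ?addr0 ?subrK !eqxx /=.
  + by rewrite (_ : (x1 == x1 + 1 + 1) = false) /= ?opprK //; lia.
  + by rewrite (_ : (x1 - 1 == x1 + 1) = false) /= ?opprK //; lia.
  + rewrite (_ : (x1 == x1 + 1) = false) /=; last lia.
    by rewrite (_ : (x2 == x2 + 1 + 1) = false) /= ?opprK //; lia.
  + rewrite (_ : (x1 == x1 + 1) = false) /=; last lia.
    by rewrite (_ : (x2 - 1 == x2 + 1) = false) /= ?opprK //; lia.
- by move=> x x0 xv; rewrite outflow_flow_of_edges fg (negPf x0) (negPf xv) subrr.
- by rewrite outflow_flow_of_edges fg eqxx eq_sym (negPf v0) subr0.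
- by rewrite outflow_flow_of_edges fg eqxx (negPf v0) sub0r.
Qed.

Lemma is_flow_edges_of_flow (v : vertex) theta : v != (0, 0) -> unit_flow (0, 0) v theta ->
  is_flow (0, 0) v (edges_of_flow theta).
Proof.
move=> v0 [anti [node [src snk]]] z; rewrite outflow_edges_of_flow //.
have [->|z0] := eqVneq z (0, 0); first by rewrite src eq_sym (negPf v0) subr0.
have [->|zv] := eqVneq z v; first by rewrite snk sub0r.
by rewrite node // subrr.
Qed.

Lemma esum_leP (F : edge -> R) (c : R) : (forall e, 0 <= F e) ->
  (\esum_(e in [set: edge]) (F e)%:E <= c%:E)%E <->
  (forall s, uniq s -> \sum_(e <- s) F e <= c).
Proof.
move=> F0; split=> [H s us|H].
  rewrite -lee_fin -sumEFin; apply: le_trans H; apply: esum_ge.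
  exists [set` s]; first by split => //; exact: finite_seq.
  by rewrite -fsbig_seq.
apply: ub_ereal_sup => _ [A [finA _] <-].
by rewrite fsbig_finite //= sumEFin lee_fin; apply: H; exact: finmap.fset_uniq.
Qed.

Lemma eff_res_ext_ge0 r x y : (forall e, 0 <= r e) -> (0 <= eff_res_ext r x y)%E.
Proof.
move=> r0; apply: le_ereal_inf_tmp => _ [theta _ <-]; apply: esum_ge0 => e _.
by rewrite lee_fin mulr_ge0 // sqr_ge0.
Qed.

Lemma eff_res_ext_le r v g c : v != (0, 0) -> (forall e, 0 <= r e) -> is_flow (0, 0) v g ->
  (forall s, uniq s -> \sum_(e <- s) r e * g e ^+ 2 <= c) ->
  (eff_res_ext r ((0, 0) : vertex)%R v <= c%:E)%E.
Proof.
move=> v0 r0 fg gc; apply: (@le_trans _ _ (energy r (flow_of_edges g))).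
  by apply: ereal_inf_lbound; exists (flow_of_edges g) => //; exact: unit_flow_of_edges.
apply/esum_leP; first by move=> e; rewrite mulr_ge0 // sqr_ge0.
move=> s us; apply: le_trans (gc s us); apply: ler_sum => e _.
by have := flow_of_edgesK g e; rewrite /edges_of_flow => ->.
Qed.

Lemma eff_res_fin r v b : v != (0, 0) -> (forall e, 0 <= r e <= b) ->
  eff_res_ext r (0, 0) v \is a fin_num.
Proof.
move=> v0 rb; have r0 e : 0 <= r e by case/andP: (rb e).
have b0 : 0 <= b by case/andP: (rb ((0, 0), true)) => h1 h2; exact: le_trans h2.
rewrite ge0_fin_numE; last exact: eff_res_ext_ge0.
have [C [C0 HC]] := sq_flow_exists R.
have [g [fg gc]] := HC v (l1norm v) (ltnW (ltn_expl _ (erefl : (1 < 2)%N))).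
apply: le_lt_trans (ltry (b * (C * (l1norm v).+1%:R))); apply: (eff_res_ext_le v0 r0 fg) => s us.
apply: (@le_trans _ _ (b * \sum_(e <- s) g e ^+ 2)); last by rewrite ler_wpM2l // gc.
rewrite big_distrr /=; apply: ler_sum => e _; apply: ler_wpM2r; first exact: sqr_ge0.
by case/andP: (rb e).
Qed.

Lemma eff_res_ge0 r x y : (forall e, 0 <= r e) -> 0 <= eff_res r x y.
Proof. by move=> r0; apply: fine_ge0; exact: eff_res_ext_ge0. Qed.

Lemma eff_res_le r v b g c : v != (0, 0) -> (forall e, 0 <= r e <= b) -> is_flow (0, 0) v g ->
  (forall s, uniq s -> \sum_(e <- s) r e * g e ^+ 2 <= c) -> eff_res r (0, 0) v <= c.
Proof.
move=> v0 rb fg gc; rewrite -lee_fin /eff_res fineK; last exact: eff_res_fin rb.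
by apply: eff_res_ext_le fg gc => // e; case/andP: (rb e).
Qed.

Lemma eff_res_bounded v b : v != (0, 0) -> 0 <= b ->
  exists B : R, forall r, (forall e, 0 <= r e <= b) -> eff_res r (0, 0) v <= B.
Proof.
move=> v0 b0; have [C [C0 HC]] := sq_flow_exists R.
have [g [fg gc]] := HC v (l1norm v) (ltnW (ltn_expl _ (erefl : (1 < 2)%N))).
exists (b * (C * (l1norm v).+1%:R)) => r rb; apply: (eff_res_le v0 rb fg) => s us.
apply: (@le_trans _ _ (b * \sum_(e <- s) g e ^+ 2)); last by rewrite ler_wpM2l // gc.
rewrite big_distrr /=; apply: ler_sum => e _; apply: ler_wpM2r; first exact: sqr_ge0.
by case/andP: (rb e).
Qed.

Lemma eff_res_near_min r v b eps : v != (0, 0) -> (forall e, 0 <= r e <= b) -> 0 < eps ->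
  exists g, near_min r v g (eff_res r (0, 0) v) eps.
Proof.
move=> v0 rb e0; have fin := eff_res_fin v0 rb.
have [_ [theta tf <-] lt] := lb_ereal_inf_adherent e0 fin.
exists (edges_of_flow theta); split.
- exact: is_flow_edges_of_flow.
- apply/esum_leP; first by move=> e; rewrite mulr_ge0 ?sqr_ge0 //; case/andP: (rb e).
  by rewrite EFinD /eff_res fineK //; exact: ltW.
- by move=> g' c fg' gc'; exact: eff_res_le rb fg' gc'.
Qed.

Lemma eff_res_mono r r' v b : v != (0, 0) -> (forall e, 0 <= r e) ->
  (forall e, r e <= r' e <= b) -> eff_res r (0, 0) v <= eff_res r' (0, 0) v.
Proof.
move=> v0 r0 rr'; apply/ler_addgt0Pr => eps e0.
have r'b e : 0 <= r' e <= b.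
  by case/andP: (rr' e) => h1 ->; rewrite (le_trans (r0 e)).
have rb e : 0 <= r e <= b.
  by case/andP: (rr' e) => h1 h2; rewrite r0 (le_trans h1).
have [g [fg gQ _]] := eff_res_near_min v0 r'b e0.
apply: (eff_res_le v0 rb fg) => s us; apply: le_trans (gQ s us).
by apply: ler_sum => e _; apply: ler_wpM2r; [exact: sqr_ge0 | case/andP: (rr' e)].
Qed.

Definition upd r (e : edge) (x : R) : edge -> R := fun f => if f == e then x else r f.

(** The almost minimal flow for [r] stays a competitor after the resistance of [e] is raised, and
    the same [g] serves for every such [e]. *)
Lemma eff_res_upd_le r v (a b : R) g Q eps e : v != (0, 0) -> 0 < a -> a <= b ->
  (forall e, a <= r e <= b) -> near_min r v g Q eps -> r e = a ->
  eff_res (upd r e b) (0, 0) v <= Q + eps + (b - a) * g e ^+ 2.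
Proof.
move=> v0 a0 ab rab [fg gQ _] re.
have rb f : 0 <= upd r e b f <= b.
  rewrite /upd; case: eqP => _; first by rewrite lexx andbT (le_trans (ltW a0)).
  by case/andP: (rab f) => h1 ->; rewrite (le_trans (ltW a0)).
apply: (eff_res_le v0 rb fg) => s us.
have E f : upd r e b f * g f ^+ 2 = r f * g f ^+ 2 + (if f == e then (b - a) * g e ^+ 2 else 0).
  by rewrite /upd; case: eqP => [->|_]; rewrite ?addr0 // re; ring.
rewrite (eq_bigr _ (fun f _ => E f)) big_split /= lerD // ?gQ //.
have ge : 0 <= (b - a) * g e ^+ 2 by rewrite mulr_ge0 ?sqr_ge0 // subr_ge0.
case: (boolP (e \in s)) => es.
  by rewrite (bigD1_seq _ es us) /= eqxx big1 ?addr0 // => f /negPf ->.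
by rewrite big_seq big1 // => f fs; case: eqP => // fe; rewrite -fe fs in es.
Qed.

Definition merge (s : seq edge) (r x : edge -> R) : edge -> R :=
  fun e => if e \in s then r e else x e.

(** A finite set nearly attaining the supremum of the partial sums lies in some ball; edges outside
    that ball can only contribute the missing [d]. *)
Lemma sq_tail g c (d : R) : sq_bounded g c -> 0 < d ->
  exists n0 : nat, forall n, (n0 <= n)%N -> forall s, uniq s ->
    \sum_(e <- s | e \notin ball n) g e ^+ 2 <= d.
Proof.
move=> gc d0.
pose E : set R := [set x | exists s, uniq s /\ x = \sum_(e <- s) g e ^+ 2].
have supE : has_sup E.
  split; first by exists 0, [::]; rewrite big_nil.
  by exists c => _ [s [us ->]]; exact: gc.
have [_ [s0 [us0 ->]] lt] := sup_adherent d0 supE.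
exists (\max_(e <- s0) rad e)%N => n n0n s us.
have s0n : {subset s0 <= ball n}.
  by move=> e es; rewrite mem_ball; apply: leq_trans n0n; exact: leq_bigmax_seq.
have : \sum_(e <- s0 ++ [seq e <- s | e \notin ball n]) g e ^+ 2 <= sup E.
  apply: sup_upper_bound => //; eexists; split; last reflexivity.
  rewrite cat_uniq us0 filter_uniq // andbT /=; apply/hasPn => e.
  by rewrite mem_filter => /andP[en _]; apply: contra en; exact: s0n.
by rewrite big_cat /= big_filter; move: lt; lra.
Qed.

(** Raising resistances raises the effective resistance, and an almost minimal flow for [r] pays at
    most [b] times its tail energy for it; near-minimality and the tail each take [d / 2]. This
    approximates the effective resistance by functions of finitely many coordinates. *)
Lemma eff_res_merge_cvg r v (a b : R) (d : R) : v != (0, 0) -> 0 < a -> a <= b ->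
  (forall e, a <= r e <= b) -> 0 < d ->
  exists n0 : nat, forall n, (n0 <= n)%N ->
   eff_res r (0, 0) v <= eff_res (merge (ball n) r (fun=> b)) (0, 0) v <= eff_res r (0, 0) v + d.
Proof.
move=> v0 a0 ab rab d0.
have rb e : 0 <= r e <= b by case/andP: (rab e) => h ->; rewrite (le_trans (ltW a0)).
have d2 : 0 < d / 2 by rewrite divr_gt0.
have [g [fg gQ _]] := eff_res_near_min v0 rb d2.
set Q := eff_res r (0, 0) v in gQ *.
have gT : sq_bounded g ((Q + d / 2) / a).
  move=> s us; rewrite ler_pdivlMr // mulrC; apply: le_trans (gQ s us); rewrite big_distrr /=.
  by apply: ler_sum => e _; apply: ler_wpM2r; [exact: sqr_ge0 | case/andP: (rab e)].
have b0 : 0 < b by exact: lt_le_trans ab.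
have [n0 Hn0] := sq_tail gT (divr_gt0 d2 b0).
exists n0 => n n0n; apply/andP; split.
  apply: (@eff_res_mono _ _ _ b v0) => e; first by case/andP: (rb e).
  by rewrite /merge; case/andP: (rb e) => h1 h2; case: ifP => _; rewrite ?h2 lexx.
have mb e : 0 <= merge (ball n) r (fun=> b) e <= b.
  by rewrite /merge; case: ifP => _ //; rewrite lexx ltW.
apply: (eff_res_le v0 mb fg) => s us.
apply: (@le_trans _ _ (\sum_(e <- s) r e * g e ^+ 2 + b * \sum_(e <- s | e \notin ball n) g e ^+ 2)).
  rewrite big_distrr /= [X in _ + X]big_mkcond -big_split /=; apply: ler_sum => e _.
  rewrite /merge; case: ifP => _ /=; first by rewrite addr0.
  by rewrite lerDr mulr_ge0 ?sqr_ge0 //; case/andP: (rb e).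
apply: (@le_trans _ _ (Q + d / 2 + b * (d / 2 / b))).
  by rewrite lerD // ?gQ // ler_pM2l // Hn0.
by rewrite (mulrC b) divfK ?gt_eqF // -addrA -splitr.
Qed.

End EffectiveResistance.

(** * Averages over finitely many fair coin flips *)

Section EfronStein.
Variables (R : realType) (a b : R).
Implicit Types (F G : (edge -> R) -> R) (r : edge -> R).

(** Expectation when the coordinates in [s] are independent fair choices between [a] and [b] and the
    others are frozen at [r], written as a recursion so that it involves no measure. *)
Fixpoint avg (s : seq edge) F r : R :=
  if s is e :: s' then (avg s' F (upd r e a) + avg s' F (upd r e b)) / 2 else F r.

Lemma avgD s F G r : avg s (fun x => F x + G x) r = avg s F r + avg s G r.
Proof. by elim: s r => //= e s IH r; rewrite !IH; ring. Qed.

Lemma avgZ s c F r : avg s (fun x => c * F x) r = c * avg s F r.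
Proof. by elim: s r => //= e s IH r; rewrite !IH; ring. Qed.

Lemma avg_cst s c r : avg s (fun=> c) r = c.
Proof. by elim: s r => //= e s IH r; rewrite !IH; field. Qed.

Lemma avg_le s F G r :
  (forall r', (forall e, (e \notin s -> r' e = r e) /\ (e \in s -> r' e = a \/ r' e = b)) ->
     F r' <= G r') -> avg s F r <= avg s G r.
Proof.
elim: s r => [|e s IH] r H /=; first by apply: H.
rewrite ler_pM2r ?invr_gt0 //; apply: lerD; apply: IH => r' Hr'; apply: H => f; rewrite inE negb_or.
  have [h1 h2] := Hr' f; split.
    by move=> /andP[fe fs]; rewrite h1 // /upd (negPf fe).
  move=> /orP[/eqP fe|]; last exact: h2.
  case: (boolP (f \in s)) => fs; first exact: h2.
  by left; rewrite h1 // /upd fe eqxx.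
have [h1 h2] := Hr' f; split.
  by move=> /andP[fe fs]; rewrite h1 // /upd (negPf fe).
move=> /orP[/eqP fe|]; last exact: h2.
case: (boolP (f \in s)) => fs; first exact: h2.
by right; rewrite h1 // /upd fe eqxx.
Qed.

Lemma avg_ext s F G r :
  (forall r', (forall e, (e \notin s -> r' e = r e) /\ (e \in s -> r' e = a \/ r' e = b)) ->
     F r' = G r') -> avg s F r = avg s G r.
Proof.
by move=> H; apply/eqP; rewrite eq_le; apply/andP; split; apply: avg_le => r' /H ->.
Qed.

Lemma updC r e f x y : e != f -> upd (upd r e x) f y = upd (upd r f y) e x.
Proof.
move=> ef; apply/funext => h; rewrite /upd.
by have [->|] := eqVneq h f => //; rewrite eq_sym (negPf ef).
Qed.

Lemma avg_upd s F r e x : e \notin s ->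
  avg s F (upd r e x) = avg s (fun r' => F (upd r' e x)) r.
Proof.
elim: s r => //= f s IH r; rewrite inE negb_or => /andP[ef es].
by rewrite !(@updC r e f) // !IH.
Qed.

Lemma avg_sqr s F r : avg s F r ^+ 2 <= avg s (fun x => F x ^+ 2) r.
Proof.
elim: s r => //= e s IH r.
have := IH (upd r e a); have := IH (upd r e b).
move: (avg s F (upd r e a)) (avg s F (upd r e b)) => p q h1 h2.
by have := sqr_ge0 (p - q); nra.
Qed.

Definition avg_var s F r : R := avg s (fun x => F x ^+ 2) r - avg s F r ^+ 2.

(* Only the increments from [a] to [b] are kept: at a given [r] they are all
   controlled by one almost minimal flow for [r]. *)
Definition one_sided e F r : R :=
  if r e == a then (F (upd r e b) - F r) ^+ 2 else 0.

Lemma one_sided_ge0 e F r : 0 <= one_sided e F r.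
Proof. by rewrite /one_sided; case: ifP => // _; exact: sqr_ge0. Qed.

Lemma one_sided_upd e F r :
  one_sided e F (upd r e a) = (F (upd r e b) - F (upd r e a)) ^+ 2.
Proof.
rewrite /one_sided {1}/upd eqxx eqxx.
by rewrite (_ : upd (upd r e a) e b = upd r e b) //; apply/funext => f; rewrite /upd; case: (f == e).
Qed.

(** Induction on [s]: the variance is the mean of the two conditional variances plus
    [(p - q)^2 / 4], with [p] and [q] the conditional means. By Jensen [(p - q)^2] is at most the
    average of [one_sided] on the branch [a]; the mean over the branches and the final half supply
    the [1 / 4]. *)
Lemma efron_stein s F r : uniq s ->
  avg_var s F r <= avg s (fun x => \sum_(e <- s) one_sided e F x) r / 2.
Proof.
elim: s r => [|e s IH] r /=; first by rewrite /avg_var /= big_nil mul0r subrr.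
move=> /andP[es us].
have split_avg x : avg s (fun x => \sum_(f <- e :: s) one_sided f F x) x =
    avg s (one_sided e F) x + avg s (fun x => \sum_(f <- s) one_sided f F x) x.
  by rewrite -avgD; congr (avg s _ x); apply/funext => y; rewrite big_cons.
rewrite !split_avg.
have Va := IH (upd r e a) us; have Vb := IH (upd r e b) us.
have Ob : 0 <= avg s (one_sided e F) (upd r e b).
  by rewrite -(avg_cst s 0 (upd r e b)); apply: avg_le => r' _; exact: one_sided_ge0.
have Oa : (avg s F (upd r e a) - avg s F (upd r e b)) ^+ 2 <= avg s (one_sided e F) (upd r e a).
  rewrite !avg_upd // -sqrrN opprB -[- avg _ _ _]mulN1r -avgZ -avgD; apply: le_trans (avg_sqr _ _ _) _.
  by apply: avg_le => r' _; rewrite one_sided_upd mulN1r.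
move: Va Vb; rewrite /avg_var /=.
move: Oa Ob; move: (avg s F (upd r e a)) (avg s F (upd r e b)) => p q Oa Ob Va Vb.
nra.
Qed.

End EfronStein.

Section AverageVariance.
Variable R : realType.

Lemma eff_res_avg_var (a b : R) : 0 < a -> a <= b ->
  exists C : R, 0 < C /\ exists N : nat, forall v : vertex, (N <= l1norm v)%N ->
  v != (0, 0) /\ forall n : nat,
  avg_var a b (ball n) (fun r => eff_res r (0, 0) v) (fun=> b) <= C * ln (l1norm v)%:R `^ (2 / 3).
Proof.
move=> a0 ab; have [C [C0 [N HN]]] := near_min_quartic a0 ab.
exists ((b - a) ^+ 2 * C + 1); split; first by rewrite ltr_wpDl // mulr_ge0 ?sqr_ge0 // ltW.
exists (maxn N 2) => v; rewrite geq_max => /andP[Nv v2].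
have v0 : v != (0, 0) by apply: contraTneq v2 => ->.
split => // n.
set F := fun r => eff_res r (0, 0) v.
pose P : R := ln (l1norm v)%:R `^ (2 / 3).
have P0 : 0 < P by apply: powR_gt0; apply: ln_gt0; rewrite ltr1n.
have [eps0 [eps00 Heps]] := HN v Nv.
pose m := (size (ball n))%:R + 1 : R.
have m1 : 1 <= m by rewrite lerDr.
have m0 : 0 < m by exact: lt_le_trans m1.
(* Each edge of the box contributes an error [2 * eps ^+ 2]; since [eps <= 1] and [eps * m <= P],
   these errors sum to at most [2 * P] whatever [n] is. *)
pose eps := Num.min eps0 (Num.min 1 (P / m)).
have e0 : 0 < eps by rewrite !lt_min eps00 ltr01 divr_gt0.
have ee0 : eps <= eps0 by rewrite ge_min lexx.
have e1 : eps <= 1 by rewrite !ge_min lexx orbT.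
have eP : eps * m <= P by rewrite -ler_pdivlMr // !ge_min lexx !orbT.
apply: le_trans (efron_stein a b F (fun=> b) (ball_uniq n)) _.
rewrite ler_pdivrMr //.
rewrite -(avg_cst a b (ball n) (_ * 2) (fun=> b)).
apply: avg_le => r Hr.
have rab e : a <= r e <= b.
  have [h1 h2] := Hr e; case: (boolP (e \in ball n)) => [/h2[]|/h1] ->; by rewrite ?lexx ?ab.
have rb e : 0 <= r e <= b by case/andP: (rab e) => h ->; rewrite (le_trans (ltW a0)).
have [g gm] := eff_res_near_min v0 rb e0.
have gq := Heps r g _ eps rab (ltW e0) ee0 gm (ball n) (ball_uniq n).
apply: (@le_trans _ _ (\sum_(e <- ball n) (2 * (b - a) ^+ 2 * g e ^+ 4 + 2 * eps ^+ 2))).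
  apply: ler_sum => e _; rewrite /one_sided; case: eqP => re; last first.
    apply: addr_ge0; last by rewrite mulr_ge0 // sqr_ge0.
    apply: mulr_ge0; first by rewrite mulr_ge0 // sqr_ge0.
    by rewrite -[4%N]/(2 * 2)%N exprM sqr_ge0.
  have h1 := eff_res_upd_le v0 a0 ab rab gm re.
  have h2 : F r <= F (upd r e b).
    apply: (@eff_res_mono _ _ _ _ b v0) => f; first by case/andP: (rb f).
    by rewrite /upd; case: eqP => _; [case/andP: (rb f) => _ ->; rewrite lexx | case/andP: (rb f) => _ ->; rewrite lexx].
  have h3 : F (upd r e b) - F r <= (b - a) * g e ^+ 2 + eps by rewrite /F; lra.
  have h4 : (F (upd r e b) - F r) ^+ 2 <= ((b - a) * g e ^+ 2 + eps) ^+ 2.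
    by rewrite lerXn2r ?nnegrE ?subr_ge0 // (le_trans _ h3) // subr_ge0.
  apply: le_trans h4 _.
  have -> : 2 * (b - a) ^+ 2 * g e ^+ 4 = 2 * ((b - a) * g e ^+ 2) ^+ 2 by ring.
  by have := sqr_ge0 ((b - a) * g e ^+ 2 - eps); nra.
rewrite big_split /= -big_distrr /= big_const_seq count_predT iter_addr_0.
have h5 : 2 * eps ^+ 2 *+ size (ball n) <= 2 * P.
  rewrite -mulr_natr -mulrA ler_pM2l // expr2.
  apply: (@le_trans _ _ (1 * (eps * m))); last by rewrite mul1r.
  rewrite -mulrA; apply: ler_pM => //; rewrite ?(ltW e0) //.
    by rewrite mulr_ge0 // ltW.
  by rewrite ler_pM2l // lerDl.
have h6 : 2 * (b - a) ^+ 2 * \sum_(e <- ball n) g e ^+ 4 <= 2 * (b - a) ^+ 2 * (C * P).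
  by rewrite ler_wpM2l // mulr_ge0 // sqr_ge0.
rewrite -/P; move: h5 h6; move: (\sum_(e <- _) _) => S; move: (_ *+ _) => Z.
lra.
Qed.

End AverageVariance.

(** * Integrals over sets of full measure and limits of variances *)

Section NullSet.
Local Open Scope ereal_scope.
Context (d : measure_display) (T : measurableType d) (R : realType).
Variable mu : {measure set T -> \bar R}.
Import HBNNSimple.

(** As [f] need not be measurable, the argument works with the simple functions below [f]:
    restricting one of them to [A] does not change its integral. *)
Lemma ge0_integral_full (A : set T) (f : T -> \bar R) : measurable A -> mu (~` A) = 0 ->
  (forall x, 0 <= f x) -> \int[mu]_x f x = \int[mu]_(x in A) f x.
Proof.
move=> mA A0 f0; rewrite [RHS]integral_mkcond.
have fA0 x : 0 <= (f \_ A) x by apply: erestrict_ge0.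
have fA x : (f \_ A) x <= f x by rewrite patchE; case: ifP.
rewrite !ge0_integralTE //; apply/eqP; rewrite eq_le; apply/andP; split.
  apply: ub_ereal_sup => _ [h hf <-]; apply: ereal_sup_ubound => /=.
  exists (proj_nnsfun h mA).
    move=> x; rewrite /proj_nnsfun /= patchE mindicE.
    by case: ifP => xA; rewrite ?mulr1 ?mulr0; [exact: hf | exact: lexx].
  rewrite -!integralT_nnsfun.
  have mh (k : {nnsfun T >-> R}) : measurable_fun setT (fun x => (k x)%:E).
    by apply/measurable_EFinP.
  rewrite [LHS](@ge0_negligible_integral _ _ _ mu _ (~` A)) //; last first.
  - by move=> x _; rewrite lee_fin.
  - exact: measurableC.
  rewrite [RHS](@ge0_negligible_integral _ _ _ mu _ (~` A)) //; last first.
  - by move=> x _; rewrite lee_fin.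
  - exact: measurableC.
  rewrite setDE setCK setTI; apply: eq_integral => x xA.
  by rewrite /proj_nnsfun /= mindicE xA mulr1.
apply: ereal_sup_le => _ [h hf <-].
by exists h => // x; exact: le_trans (hf x) (fA x).
Qed.

(* The integrand need not be measurable outside the set of full measure. *)
Lemma integral_full (A : set T) (f : T -> \bar R) : measurable A -> mu (~` A) = 0 ->
  \int[mu]_x f x = \int[mu]_(x in A) f x.
Proof.
move=> mA A0; rewrite integralE [RHS]integralE.
by congr (_ - _); apply: ge0_integral_full.
Qed.

End NullSet.

Section VarianceLimit.
Context (d : measure_display) (T : measurableType d) (R : realType).
Variable P : probability T R.

(** Dominated convergence is applied twice on [A], to the means and then to the squared deviations,
    bounded by [B ^+ 2]. Off [A] nothing is known about [X], not even measurability, and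
    [integral_full] discards that part. *)
Lemma variance_le_limit (A : set T) (X : T -> R) (Xn : nat -> T -> R) (B V : R) :
  measurable A -> P (~` A) = 0%E ->
  (forall n, measurable_fun A (Xn n)) ->
  (forall n w, A w -> 0 <= Xn n w <= B) ->
  (forall w, A w -> Xn ^~ w @ \oo --> X w) ->
  (forall n, (\int[P]_(w in A)
     ((Xn n w - fine (\int[P]_(w in A) (Xn n w)%:E)) ^+ 2)%:E <= V%:E)%E) ->
  (variance P X <= V%:E)%E.
Proof.
move=> mA A0 mXn XnB cX HV.
have [A1|/set0P[w0 Aw0]] := eqVneq A set0.
  by move: A0; rewrite A1 setC0 probability_setT => /eqP; rewrite onee_eq0.
have B0 : 0 <= B by case/andP: (XnB 0%N w0 Aw0) => h1 h2; exact: le_trans h2.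
have mX : measurable_fun A X by exact: (measurable_fun_cvg mXn).
have PA : P A = 1%E.
  have := probability_setC P mA; rewrite A0; case: (P A) (probability_le1 P mA) (fin_num_measure P A mA) => // p _ _.
  by move=> /eqP; rewrite -EFinB eqe => /eqP h; congr (_%:E); lra.
have icst (k : R) : P.-integrable A (EFin \o cst k) by exact: finite_measure_integrable_cst.
have cvgE (u : nat -> R) (l : R) : u @ \oo --> l -> (fun n => (u n)%:E) @ \oo --> l%:E.
  by move=> ul; apply: cvg_EFin; [exact: nearW | exact: ul].
pose mn n := fine (\int[P]_(w in A) (Xn n w)%:E).
pose m := fine (\int[P]_(w in A) (X w)%:E).
have mnE n : (\int[P]_(w in A) (Xn n w)%:E)%E = (mn n)%:E /\ 0 <= mn n <= B.
  have i0 : (0 <= \int[P]_(w in A) (Xn n w)%:E)%E.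
    by apply: integral_ge0 => w Aw; rewrite lee_fin; case/andP: (XnB n w Aw).
  have i1 : (\int[P]_(w in A) (Xn n w)%:E <= B%:E)%E.
    apply: (@le_trans _ _ (\int[P]_(w in A) (cst B%:E w))%E); last first.
      rewrite integral_cst //.
      by rewrite (_ : (_ * _)%E = B%:E) // -[RHS]mule1; congr (_ * _)%E; exact: PA.
    apply: ge0_le_integral => //.
    - by move=> w Aw; rewrite lee_fin; case/andP: (XnB n w Aw).
    - exact/measurable_EFinP.
    - by move=> w Aw; rewrite /cst lee_fin; case/andP: (XnB n w Aw).
  have fi : (\int[P]_(w in A) (Xn n w)%:E)%E \is a fin_num.
    by rewrite ge0_fin_numE // (le_lt_trans i1) // ltry.
  by rewrite /mn fineK //; split => //; rewrite -!lee_fin fineK // i0 i1.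
have cm : mn @ \oo --> m.
  have dom : \forall w \ae P, forall n : nat, A w -> (`|(Xn n w)%:E| <= (EFin \o cst B) w)%E.
    apply: aeW => w n Aw; case/andP: (XnB n w Aw) => h1 h2.
    by rewrite /= lee_fin ger0_norm.
  have cvgX : \forall w \ae P, A w -> (Xn n w)%:E @[n --> \oo] --> (X w)%:E.
    by apply: aeW => w Aw; apply: cvgE; exact: cX.
  have [iX _ H] := dominated_convergence mA
    (fun n => (measurable_EFinP _ _).2 (mXn n)) ((measurable_EFinP _ _).2 mX) cvgX (icst B) dom.
  apply: fine_cvg; rewrite /m fineK; first exact: H.
  exact: integrable_fin_num.
rewrite /variance covariance.unlock expectation.unlock.
have -> : fine (\int[P]_w (X w)%:E) = m by rewrite (integral_full _ mA A0).
rewrite (integral_full _ mA A0).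
pose Y n w := (Xn n w - mn n) ^+ 2.
have mY n : measurable_fun A (Y n).
  by apply: measurable_funX; apply: measurable_funB.
have mY' : measurable_fun A (fun w => (X w - m) ^+ 2).
  by apply: measurable_funX; apply: measurable_funB.
have domY : \forall w \ae P, forall n : nat, A w -> (`|(Y n w)%:E| <= (EFin \o cst (B ^+ 2)%R) w)%E.
  apply: aeW => w n Aw; case/andP: (XnB n w Aw) => h1 h2.
  have [_ /andP[h3 h4]] := mnE n.
  rewrite /= lee_fin ger0_norm ?sqr_ge0 //.
  rewrite -[leLHS]real_normK ?num_real // lerXn2r ?nnegrE //.
  by rewrite ler_norml; apply/andP; split; lra.
have cvgY : \forall w \ae P, A w -> (Y n w)%:E @[n --> \oo] --> ((X w - m) ^+ 2)%:E.
  apply: aeW => w Aw; apply: cvgE; rewrite expr2 /Y.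
  under eq_fun do rewrite expr2.
  by apply: cvgM; apply: cvgB => //; exact: cX.
have [_ _ H] := dominated_convergence mA
    (fun n => (measurable_EFinP _ _).2 (mY n)) ((measurable_EFinP _ _).2 mY') cvgY (icst _) domY.
apply: (cvge_le _ H).
by apply: nearW => n; exact: HV.
Qed.

End VarianceLimit.

(** * Independent resistances *)

Section Iid.
Context (d : measure_display) (T : measurableType d) (R : realType).
Variables (P : probability T R) (r : edge -> T -> R) (a b : R).
Hypothesis mr : forall e, measurable_fun setT (r e).
Hypothesis iid : iid_nu P r a b.

Lemma measurable_level e (y : R) : measurable [set w | r e w = y].
Proof.
have := mr e measurableT (measurable_set1 y).
by rewrite setTI.
Qed.

Definition good : set T := [set w | forall e, r e w = a \/ r e w = b].

(** Enumerating the edges through [unpickle] turns [good] into a countable intersection. *)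
Definition good_at (n : nat) : set T :=
  if unpickle n is Some e then [set w | r e w = a] `|` [set w | r e w = b] else setT.

Lemma goodE : good = \bigcap_n good_at n.
Proof.
apply/seteqP; split=> w.
  by move=> gw n _; rewrite /good_at; case: unpickle => //= e; exact: gw.
by move=> H e; have := H (pickle e) I; rewrite /good_at pickleK.
Qed.

Lemma measurable_good_at n : measurable (good_at n).
Proof.
by rewrite /good_at; case: unpickle => [e|] //; apply: measurableU; exact: measurable_level.
Qed.

Lemma measurable_good : measurable good.
Proof. by rewrite goodE; apply: bigcapT_measurable => n; exact: measurable_good_at. Qed.

Definition cylinder (t : seq edge) (x : edge -> R) : set T :=
  \bigcap_(e in [set` t]) [set w | r e w = x e].

Lemma cylinder1 e x : cylinder [:: e] x = [set w | r e w = x e].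
Proof.
apply/seteqP; split=> w /=; first by apply; rewrite /= inE.
by move=> rw f; rewrite /= inE => /eqP ->.
Qed.

Lemma measurable_cylinder t x : measurable (cylinder t x).
Proof.
apply: fin_bigcap_measurable; first exact: finite_seq.
by move=> e _; exact: measurable_level.
Qed.

Lemma prob_level e y : P [set w | r e w = y] = (nu_mass a b y)%:E.
Proof.
have := @iid [:: e] isT (fun=> y).
by rewrite -/(cylinder _ _) cylinder1 big_seq1.
Qed.

Lemma nu_mass_neq : a != b -> nu_mass a b a = 1 / 2 /\ nu_mass a b b = 1 / 2.
Proof.
by move=> ab; rewrite /nu_mass !eqxx (negPf ab) eq_sym (negPf ab) addr0 add0r.
Qed.

Lemma nu_mass_eq : a = b -> nu_mass a b a = 1.
Proof. by move=> ->; rewrite /nu_mass eqxx; field. Qed.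

Lemma prob_good_at n : P (~` good_at n) = 0%E.
Proof.
rewrite probability_setC; last exact: measurable_good_at.
suff -> : P (good_at n) = 1%E by rewrite subee.
rewrite /good_at; case: unpickle => [e|]; last exact: probability_setT.
(* For [a = b] the two levels coincide and the halves in [nu_mass] add up to [1]; otherwise the
   levels are disjoint. *)
have [ab|ab] := eqVneq a b.
  by rewrite -ab setUid prob_level nu_mass_eq.
have [na nb] := nu_mass_neq ab.
rewrite measureU; [|exact: measurable_level|exact: measurable_level|].
  transitivity ((1 / 2)%:E + (1 / 2)%:E : \bar R)%E; last by rewrite -EFinD; congr (_%:E); field.
  by congr (_ + _)%E; [rewrite -na; exact: prob_level | rewrite -nb; exact: prob_level].
by apply/seteqP; split=> w //= [-> ab']; move: ab; rewrite ab' eqxx.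
Qed.

Lemma prob_good : P (~` good) = 0%E.
Proof.
apply/negligibleP; first by apply: measurableC; exact: measurable_good.
rewrite goodE setC_bigcap; apply: negligible_bigcup => n.
by apply/negligibleP; [apply: measurableC; exact: measurable_good_at | exact: prob_good_at].
Qed.

Lemma prob_good_cylinder t x : uniq t ->
  P (good `&` cylinder t x) = (\prod_(e <- t) nu_mass a b (x e))%:E.
Proof.
move=> ut; rewrite -(iid ut x).
have mg := measurable_good; have mc := measurable_cylinder t x.
have z : P (cylinder t x `\` good) = 0%E.
  apply: (subset_measure0 _ _ _ prob_good); [exact: measurableD|exact: measurableC|].
  by move=> w [].
transitivity (P (cylinder t x `\` good) + P (cylinder t x `&` good))%E.
  by rewrite z add0e setIC.
by symmetry; exact: measureDI.
Qed.

Lemma cylinder_upd_cons e t x y w : e \notin t ->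
  cylinder (e :: t) (upd x e y) w <-> r e w = y /\ cylinder t x w.
Proof.
move=> et; split.
  move=> H; split; first by have := H e; rewrite /= inE eqxx /upd eqxx; apply.
  move=> f ft; have := H f; rewrite /= inE ft orbT /upd.
  by case: eqP => [fe|_]; [rewrite -fe ft in et | apply].
move=> [re H] f; rewrite /= inE /upd => /orP[/eqP ->|ft]; first by rewrite eqxx.
by case: eqP => [->|_] //; exact: H.
Qed.

Lemma merge_cons_upd e s x (rho : edge -> R) y : e \notin s -> rho e = y ->
  merge (e :: s) rho x = merge s rho (upd x e y).
Proof.
move=> es re; apply/funext => f; rewrite /merge inE /upd.
by have [->|fe] := eqVneq f e; rewrite ?(negPf es) ?re //=.
Qed.

(** The coordinates in [t] are already revealed, those in [s] still random. Revealing the head [e]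
    cuts the cylinder according to the value [a] or [b] of [r e], moves [e] into [t] and matches the
    recursion of [avg], the weights coming from [nu_mass]. Once [s] is empty the integrand is
    constant, which gives measurability for an [H] without regularity. *)
Lemma integral_merge (H : (edge -> R) -> R) : (forall x, 0 <= H x) ->
  forall s t x, uniq (s ++ t) ->
  measurable_fun (good `&` cylinder t x) (fun w => H (merge s (r ^~ w) x)) /\
  (\int[P]_(w in good `&` cylinder t x) (H (merge s (r ^~ w) x))%:E)%E =
  (avg a b s H x * \prod_(e <- t) nu_mass a b (x e))%:E.
Proof.
move=> H0; elim=> [|e s IH] t x /=.
  move=> ut; have mE w : merge [::] (r ^~ w) x = x by apply/funext => f; rewrite /merge in_nil.
  split; first by under eq_fun do rewrite mE; exact: measurable_cst.
  under eq_integral do rewrite mE.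
  rewrite integral_cst; last by apply: measurableI; [exact: measurable_good | exact: measurable_cylinder].
  by rewrite EFinM; congr (_ * _)%E; exact: prob_good_cylinder.
rewrite mem_cat negb_or => /andP[/andP[es et] ust].
have ust' : uniq (s ++ e :: t).
  by rewrite -cat1s uniq_catCA /= mem_cat negb_or es et.
pose D y := good `&` cylinder (e :: t) (upd x e y).
have mD y : measurable (D y) by apply: measurableI; [exact: measurable_good | exact: measurable_cylinder].
have DE y w : D y w <-> [/\ good w, r e w = y & cylinder t x w].
  by split=> [[gw /(cylinder_upd_cons _ _ _ et)[]] | [gw re cw]] //; split => //; apply/cylinder_upd_cons.
have mergeE y w : D y w -> merge (e :: s) (r ^~ w) x = merge s (r ^~ w) (upd x e y).
  by move=> /DE[_ re _]; exact: merge_cons_upd.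
have unionE : good `&` cylinder t x = D a `|` D b.
  apply/seteqP; split=> w.
    by move=> [gw cw]; case: (gw e) => re; [left|right]; apply/DE.
  by move=> [] /DE[].
have mF y : measurable_fun (D y) (fun w => H (merge (e :: s) (r ^~ w) x)).
  apply/(@measurable_fun_eqP _ _ _ _ _ _ (fun w => H (merge s (r ^~ w) (upd x e y)))).
    by move=> w; rewrite inE => Dw; rewrite (mergeE y).
  by have [] := IH (e :: t) (upd x e y) ust'.
have prodE y : \prod_(f <- t) nu_mass a b (upd x e y f) = \prod_(f <- t) nu_mass a b (x f).
  rewrite big_seq [RHS]big_seq; apply: eq_bigr => f ft; rewrite /upd.
  by case: eqP => // fe; rewrite -fe ft in et.
have iF y : (\int[P]_(w in D y) (H (merge (e :: s) (r ^~ w) x))%:E)%E =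
    (avg a b s H (upd x e y) * (nu_mass a b y * \prod_(f <- t) nu_mass a b (x f)))%:E.
  have updE : upd x e y e = y by rewrite /upd eqxx.
  have [_] := IH (e :: t) (upd x e y) ust'; rewrite big_cons prodE updE => <-.
  by apply: eq_integral => w; rewrite inE => Dw; rewrite (mergeE y).
have mU : measurable_fun (D a `|` D b) (fun w => H (merge (e :: s) (r ^~ w) x)).
  by apply/measurable_funU.
rewrite unionE; split => //.
have [ab|ab] := eqVneq a b.
  have -> : D b = D a by rewrite ab.
  have -> : upd x e b = upd x e a by rewrite ab.
  by rewrite setUid iF nu_mass_eq // mul1r; congr (_%:E); field.
have [na nb] := nu_mass_neq ab.
rewrite ge0_integral_setU //; last first.
- apply/disj_set2P/seteqP; split=> w // -[/DE[_ ra _] /DE[_ rb _]].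
  by move: ab; rewrite -ra rb eqxx.
- by move=> w _; rewrite lee_fin.
- exact/measurable_EFinP.
by rewrite !iF na nb -EFinD; congr (_%:E); field.
Qed.

Lemma integral_merge_good (H : (edge -> R) -> R) s x : (forall x, 0 <= H x) -> uniq s ->
  measurable_fun good (fun w => H (merge s (r ^~ w) x)) /\
  (\int[P]_(w in good) (H (merge s (r ^~ w) x))%:E)%E = (avg a b s H x)%:E.
Proof.
move=> H0 us; have := @integral_merge H H0 s [::] x; rewrite cats0 => /(_ us).
have -> : cylinder [::] x = setT.
  by apply/seteqP; split=> // w _ e; rewrite /= in_nil.
by rewrite setIT big_nil mulr1.
Qed.

End Iid.

Theorem theorem1 (R : realType) (a b : R) :
  0 < a -> a <= b ->
  exists C : R, 0 < C /\
  exists N : nat,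
    forall (d : measure_display) (T : measurableType d)
           (P : probability T R) (r : edge -> T -> R),
      (forall e, measurable_fun setT (r e)) ->
      iid_nu P r a b ->
      forall v : vertex, (N <= l1norm v)%N ->
        (variance P (fun w => eff_res (fun e => r e w) ((0, 0) : vertex)%R v)
          <= (C * (ln (l1norm v)%:R) `^ (2 / 3))%:E)%E.
Proof.
move=> a0 ab; have [C [C0 [N HN]]] := eff_res_avg_var a0 ab.
exists C; split => //; exists N => d T P r mr iid v Nv.
have [v0 HV] := HN v Nv.
have b0 : 0 < b by exact: lt_le_trans ab.
(* The absolute value makes [F] nonnegative on every environment, as [integral_merge] demands; on
   environments with values in [[a, b]] it changes nothing. *)
pose F (x : edge -> R) : R := `|eff_res x (0, 0) v|.
pose Xn n w : R := F (merge (ball n) (r ^~ w) (fun=> b)).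
have bnd (x : edge -> R) : (forall e, a <= x e <= b) -> forall e, 0 <= x e <= b.
  by move=> xab e; case/andP: (xab e) => h ->; rewrite (le_trans (ltW a0)).
have FE x : (forall e, a <= x e <= b) -> F x = eff_res x (0, 0) v.
  by move=> /bnd xb; rewrite /F ger0_norm // eff_res_ge0 // => e; case/andP: (xb e).
have good_ab w : good r a b w -> forall e, a <= r e w <= b.
  by move=> gw e; case: (gw e) => ->; rewrite lexx ab.
have merge_ab n w : good r a b w -> forall e, a <= merge (ball n) (r ^~ w) (fun=> b) e <= b.
  by move=> gw e; rewrite /merge; case: ifP => _; [exact: good_ab | rewrite ab lexx].
have [B HB] := eff_res_bounded v0 (ltW b0).
apply: (@variance_le_limit _ _ _ P (good r a b) _ Xn B) => //.
- exact: measurable_good.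
- exact: prob_good.
- move=> n; apply: (integral_merge_good mr iid _ _ (ball_uniq n)).1 => x; exact: normr_ge0.
- move=> n w gw; apply/andP; split; first exact: normr_ge0.
  rewrite /Xn FE; last exact: merge_ab.
  by apply: HB; apply: bnd; exact: merge_ab.
- move=> w gw; apply/cvgrPdist_le => e e0.
  have [n0 Hn0] := eff_res_merge_cvg v0 a0 ab (good_ab w gw) e0.
  exists n0 => // n /= n0n; rewrite /Xn FE; last exact: merge_ab.
  by case/andP: (Hn0 n n0n) => h1 h2; rewrite ler_norml; apply/andP; split; lra.
move=> n.
have reach x : (forall e, (e \notin ball n -> x e = b) /\ (e \in ball n -> x e = a \/ x e = b)) ->
    forall e, a <= x e <= b.
  move=> Hx e; have [h1 h2] := Hx e; case: (boolP (e \in ball n)) => [/h2[]|/h1] ->;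
    by rewrite ?lexx ?ab.
have [_ meanE] := @integral_merge_good _ _ _ P r a b mr iid F (ball n) (fun=> b)
  (fun x => normr_ge0 _) (ball_uniq n).
rewrite meanE /=; set c := avg _ _ _ F _.
have [_ ->] := @integral_merge_good _ _ _ P r a b mr iid (fun x => (F x - c) ^+ 2) (ball n) (fun=> b)
  (fun x => sqr_ge0 _) (ball_uniq n).
rewrite lee_fin; apply: le_trans (HV n).
(* Expanding the square turns the average into [avg_var], by linearity of [avg] and because [c] is
   the mean of [F]. *)
rewrite (_ : (fun x => (F x - c) ^+ 2) = fun x => F x ^+ 2 + (- (2 * c) * F x + c ^+ 2)); last first.
  by apply/funext => x; ring.
rewrite !avgD avgZ avg_cst -/c /avg_var.
have -> : avg a b (ball n) (fun x => eff_res x (0, 0) v) (fun=> b) = c.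
  by apply: avg_ext => x Hx; rewrite FE //; exact: reach.
have -> : avg a b (ball n) (fun x => eff_res x (0, 0) v ^+ 2) (fun=> b) =
    avg a b (ball n) (fun x => F x ^+ 2) (fun=> b).
  by apply: avg_ext => x Hx; rewrite FE //; exact: reach.
by rewrite le_eqVlt; apply/orP; left; apply/eqP; ring.
Qed.
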